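(* Let $B=B(V,E)$ be a $0$-$1$ simple stationary Bratteli diagram with vertex set $V$, edge set $E$ and corresponding $0$-$1$ matrix $A=(a_{i,j})_{i,j\in V}$. Let $m$ be a Borel probability measure on $X_B$ that is the tail-invariant probability measure, a stationary Markov measure, or a quasi-stationary Markov measure, let $\{\sigma_e:e\in E\}$ be the semibranching function system on $(X_B,m)$ with coding map $\sigma$, and consider the representation $\widetilde\pi$ of $\mathcal O_{\widetilde A}$, where $\widetilde A=(\widetilde a_{e,f})_{e,f\in E}$ and $\widetilde a_{e,f}=1\iff r(e)=s(f)$, generated on $L^2(X_B,m)$ by the operators $$(\widetilde T_e\psi)(x)=\chi_{R_e}(x)\,\rho_m(\sigma(x),\sigma_e)^{-1/2}\,\psi(\sigma(x)),\qquad e\in E,$$ $$(\widetilde T_e^*\xi)(x)=\chi_{D_e}(x)\,\rho_m(x,\sigma_e)^{1/2}\,\xi(\sigma_e(x)),\qquad e\in E.$$ For each $i\in V$ define $$T_i=\sum_{e\,:\,s(e)=i}\widetilde T_e .$$ Then the collection of operators $\{T_i:i\in V\}$ generates a representation of $\mathcal O_A$ on $L^2(X_B,m)$.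
   Context: $0$-$1$ stationary simple Bratteli diagram. $V$ is a finite set, $A=(a_{i,j})_{i,j\in V}$ is a primitive $0$-$1$ matrix, and $E$ is the set of edges: there is exactly one edge $e\in E$ with source $s(e)=i$ and range $r(e)=j$ if $a_{i,j}=1$, and none otherwise. The diagram $B$ has top level $V_0=\{v_0\}$, all levels $V_n$ ($n\ge1$) are copies of $V$, there is exactly one edge from $v_0$ to each vertex of $V_1$, and the edges between $V_n$ and $V_{n+1}$ ($n\ge1$) are a copy of $E$. $X_B$ is the set of infinite paths $x=(x_0,x_1,x_2,\ldots)$, $x_0$ an edge from $v_0$, $x_i\in E$ for $i\ge1$, with $r(x_i)=s(x_{i+1})$ for all $i\geq 0$; its topology is generated by the cylinder sets $[(e_0,\ldots,e_n)]=\{x:x_i=e_i,\ 0\le i\le n\}$ and $X_B$ is assumed to be a Cantor set. All measures are assumed Borel and non-atomic. Tail-invariant measure: a measure on $X_B$ such that any two cylinder sets of the same length ending at the same vertex have equal measure (unique as a probability measure). Markov measure: given $P_0=(p^{(0)}_{v_0,e})$ indexed by edges $e$ from $v_0$ and matrices $P_n=(p^{(n)}_{v,e})_{v\in V,e\in E}$, $n\ge1$, with $p^{(n)}_{v,e}>0\iff s(e)=v$ and $\sum_{e:s(e)=v}p^{(n)}_{v,e}=1$ for all $v$ (for all $n\ge0$), the Markov measure is given by $m([(e_0,\ldots,e_n)])=p^{(0)}_{v_0,e_0}p^{(1)}_{s(e_1),e_1}\cdots p^{(n)}_{s(e_n),e_n}$. It is stationary if $P_n=P$ for all $n\ge1$,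 and quasi-stationary if $0<\prod_{i=1}^\infty p^{(i+1)}_{s(x_i),x_i}/p^{(i)}_{s(x_i),x_i}<\infty$ for every $x\in X_B$. The system on $X_B$: for $e\in E$, $D_e=\{y\in X_B:s(y_1)=r(e)\}$, $R_e=\{y\in X_B:y_1=e\}$, $\sigma_e:D_e\to R_e$, $\sigma_e(y)=(y'_0,e,y_1,y_2,\ldots)$ with $y'_0$ the edge from $v_0$ to $s(e)$; the coding map is $\sigma(x)=(z'_0,x_2,x_3,\ldots)$ with $z'_0$ the edge from $v_0$ to $s(x_2)$. For such $m$ one has $m\circ\sigma_e\ll m$ on $D_e$ (where $(m\circ\sigma_e)(C)=m(\sigma_e(C))$) and $\rho_m(x,\sigma_e):=\frac{d\,m\circ\sigma_e}{dm}(x)>0$ for a.e. $x\in D_e$. Cuntz-Krieger algebra: for a $0$-$1$ matrix $A=(a_{i,j})$, $\mathcal O_A$ is the $C^*$-algebra generated by partial isometries $S_i$ with $\sum_iS_iS_i^*=1$, $S_i^*S_i=\sum_ja_{i,j}S_jS_j^*$; operators $\{T_i\}$ satisfying these relations generate a representation of $\mathcal O_A$. *)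

(* Defs.v *)
From HB Require Import structures.
From mathcomp Require Import all_boot all_order all_algebra.
From mathcomp Require Import finmap.
From mathcomp Require Import all_classical all_reals all_analysis.
From mathcomp Require Import measurable_realfun ring_quotient complex ring lra.

Set Implicit Arguments.
Unset Strict Implicit.
Unset Printing Implicit Defensive.

Import Order.TTheory GRing.Theory Num.Theory.
Import numFieldNormedType.Exports.

Local Open Scope classical_set_scope.
Local Open Scope ring_scope.
Local Open Scope quotient_scope.
Local Open Scope complex_scope.
Local Open Scope charge_scope.

(* A 0-1 matrix indexed by [V] is given as a boolean relation on [V]. *)
Definition adj_matrix (V : finType) (a : rel V) : 'M[nat]_#|V| :=
  \matrix_(i, j) nat_of_bool (a (enum_val i) (enum_val j)).

Definition primitive (V : finType) (a : rel V) : Prop :=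
  exists k, (0 < k)%N /\ forall i j, (0 < (adj_matrix a ^+ k) i j)%N.

Record bratteli := Bratteli {
  vertex :> finType;
  adj : rel vertex;
  adj_primitive : primitive adj;
  vertex_gt0 : (0 < #|vertex|)%N
}.

Definition edge (B : bratteli) : finType :=
  {ij : vertex B * vertex B | adj ij.1 ij.2}.

Definition src (B : bratteli) (e : edge B) : B := (val e).1.
Definition tgt (B : bratteli) (e : edge B) : B := (val e).2.

Lemma has_out_edge (B : bratteli) (v : B) : {e : edge B | src e = v}.
Proof.
apply: cid.
have [[|k] [//= _ /(_ (enum_rank v) (enum_rank v))]] := adj_primitive B.
rewrite exprS mxE lt0n sum_nat_eq0 => /forallPn /= [l].
rewrite mxE enum_rankK; case: (boolP (adj _ _)) => [al _|_]; last first.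
  by rewrite mul0r.
by exists (exist _ (v, enum_val l) al).
Qed.

Section path_space.
Variable B : bratteli.
Local Notation V := (vertex B).
Local Notation E := (edge B).

(* A pair [(v, u)] codes the path x with x_0 the unique edge from v_0 to v and
   x_i = u (i - 1) for i >= 1. *)
Definition is_path (x : V * (nat -> E)) : bool :=
  `[< src (x.2 0%N) = x.1 /\ forall i, src (x.2 i.+1) = tgt (x.2 i) >].

Record path_space := Path {
  path_val : V * (nat -> E);
  _ : is_path path_val
}.

HB.instance Definition _ := [isSub for path_val].
HB.instance Definition _ := gen_eqMixin path_space.
HB.instance Definition _ := gen_choiceMixin path_space.

(* [start x] is r(x_0), and [pedge x i] is x_i; only i >= 1 is meaningful. *)
Definition start (x : path_space) : V := (val x).1.
Definition pedge (x : path_space) (i : nat) : E := (val x).2 i.-1.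

Definition some_path (v : V) : V * (nat -> E) :=
  (v, fun n => iter n (fun e => sval (has_out_edge (tgt e)))
                      (sval (has_out_edge v))).

Lemma some_pathP v : is_path (some_path v).
Proof.
by apply/asboolP; split=> [|i]; exact: (svalP (has_out_edge _)).
Qed.

HB.instance Definition _ :=
  isPointed.Build path_space (Path (some_pathP (enum_val (Ordinal (vertex_gt0 B))))).

(* A finite path (e_0, ..., e_n) is coded by v = r(e_0) and s = [e_1; ...; e_n]. *)
Fixpoint is_fpath (v : V) (s : seq E) : bool :=
  if s is e :: s' then (src e == v) && is_fpath (tgt e) s' else true.

Definition fpath_end (v : V) (s : seq E) : V := last v (map (@tgt B) s).

Definition cylinder (v : V) (s : seq E) : set path_space :=
  [set x | start x = v /\ [seq pedge x i | i <- iota 1 (size s)] = s].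

HB.instance Definition _ := @isSubBaseTopological.Build path_space
  (set path_space)
  [set C | exists v s, is_fpath v s /\ C = cylinder v s]
  id.

HB.instance Definition _ :=
  @isMeasurable.Build (sigma_display (@open path_space)) path_space
    <<s @open path_space >> (@sigma_algebra0 _ setT (@open path_space))
    (@sigma_algebraC path_space (@open path_space))
    (@sigma_algebra_bigcup _ setT (@open path_space)).

End path_space.

Definition cantor_set (T : topologicalType) : Prop :=
  exists (f : T -> cantor_space) (g : cantor_space -> T),
    [/\ cancel f g, cancel g f, continuous f & continuous g].

Section coding.
Variable B : bratteli.
Local Notation E := (edge B).
Local Notation X := (path_space B).

Definition D_set (e : E) : set X := [set y | src (pedge y 1) = tgt e].
Definition R_set (e : E) : set X := [set y | pedge y 1 = e].

Lemma pathP (x : X) :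
  src (pedge x 1) = start x /\
  forall i, src (pedge x i.+2) = tgt (pedge x i.+1).
Proof. by case: x => -[v u] p /=; have /asboolP := p. Qed.

Lemma coding_subproof (x : X) :
  is_path (src (pedge x 2), fun n => pedge x n.+2).
Proof.
by apply/asboolP; split=> //= i; have [_ ->] := pathP x.
Qed.

Definition coding (x : X) : X := Path (coding_subproof x).

(* For y in [D_set e] this is (y'_0, e, y_1, y_2, ...); outside [D_set e] that
   sequence is not a path and the value is y, which is never used. *)
Definition sigma (e : E) (y : X) : X :=
  insubd y (src e, fun n => if n is n'.+1 then pedge y n'.+1 else e).

Lemma sigma_val e y : D_set e y ->
  val (sigma e y) = (src e, fun n => if n is n'.+1 then pedge y n'.+1 else e).
Proof.
move=> Dy; rewrite insubdK//; apply/asboolP; split=> //= -[|i] //.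
by have [_ ->] := pathP y.
Qed.

Lemma path_eq (x y : X) : start x = start y ->
  (forall i, pedge x i.+1 = pedge y i.+1) -> x = y.
Proof.
move=> sxy pxy; apply: val_inj; case: x y sxy pxy => -[v u] p [[w t] q].
rewrite /start /pedge /= => -> ut; congr (_, _).
by apply/funext => i; exact: ut.
Qed.

Lemma image_sigma e (C : set X) :
  sigma e @` (C `&` D_set e) = coding @^-1` C `&` R_set e.
Proof.
apply/seteqP; split => [_ [y [Cy Dy] <-]|x [Cx Rx]] /=.
  split; last by rewrite /R_set /= /pedge sigma_val.
  suff -> : coding (sigma e y) = y by [].
  apply: path_eq => [|i]; last by rewrite {1}/pedge /= /pedge sigma_val.
  by rewrite {1}/start /= /pedge sigma_val //= ; have [-> _] := pathP y.
have Dx : D_set e (coding x).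
  by rewrite /D_set /= -Rx; have [_ <-] := pathP x.
exists (coding x); first by [].
apply: path_eq => [|[|i]]; rewrite /start /pedge sigma_val//=.
by rewrite -Rx; have [-> _] := pathP x.
Qed.

Lemma open_cylinder v (s : seq E) : is_fpath v s -> open (cylinder v s).
Proof.
move=> vs; exists [set cylinder v s]; last by rewrite bigcup_set1.
move=> _ ->; exists [fset (cylinder v s)]%fset.
  by move=> C /fset1P ->; rewrite inE; exists v, s.
apply/seteqP; split=> [x /(_ (cylinder v s))|x Cx C /fset1P ->//].
by apply; apply/fset1P.
Qed.

Lemma open_coding (A : set X) : open A -> open (coding @^-1` A).
Proof.
move=> [F FI <-]; rewrite preimage_bigcup; apply: bigcup_open => G /FI.
move=> [K KC <-]; rewrite preimage_bigcap.
rewrite bigcap_fset big_seq.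
apply: (@big_ind _ open); [exact: openT|exact: openI|move=> C /KC].
rewrite inE => -[v [s [vs ->]]].
rewrite (_ : _ @^-1` _ =
  \bigcup_(e in [set e : E | tgt e = v]) cylinder (src e) (e :: s)).
  by apply: bigcup_open => e /= ev; apply: open_cylinder; rewrite /= eqxx ev.
have cE (x : X) n : [seq pedge (coding x) i | i <- iota 1 n] =
                    [seq pedge x i | i <- iota 2 n].
  rewrite (iotaDl 1 1) -map_comp; apply/eq_in_map => -[|i] //.
  by rewrite mem_iota.
apply/seteqP; split=> [x [/= sv xs]|x [e /= ev [xe /= [x1 xs]]]].
  have [p1 p2] := pathP x.
  exists (pedge x 1) => /=; first by rewrite -p2; exact: sv.
  by split=> /=; [rewrite p1 | rewrite -cE xs].
split; last by rewrite cE.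
by rewrite -ev -x1; have [_ <-] := pathP x.
Qed.

Lemma measurable_R_set e : measurable (R_set e).
Proof.
apply: sub_sigma_algebra.
rewrite (_ : R_set e = cylinder (src e) [:: e]).
  by apply: open_cylinder; rewrite /= eqxx.
apply/seteqP; split=> x /=; first by move=> <-; have [-> _] := pathP x.
by move=> [_ []].
Qed.

Lemma measurable_coding : measurable_fun [set: X] coding.
Proof.
apply: (@measurability _ _ _ _ _ _ (@open X)) => // _ [A oA <-].
by rewrite setTI; apply: sub_sigma_algebra; exact: open_coding.
Qed.

End coding.

Section measures.
Variables (R : realType) (B : bratteli).
Local Notation E := (edge B).
Local Notation X := (path_space B).
Implicit Type m : probability X R.

Local Open Scope ereal_scope.

Definition nonatomic m : Prop := forall A : set X, measurable A -> 0 < m A ->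
  exists C : set X, [/\ measurable C, C `<=` A, 0 < m C & m C < m A].

Definition tail_invariant m : Prop :=
  forall (v w : B) (s t : seq E), is_fpath v s -> is_fpath w t ->
    size s = size t -> fpath_end v s = fpath_end w t ->
    m (cylinder v s) = m (cylinder w t).

Local Close Scope ereal_scope.

(* The edges starting at v_0 are indexed by their range. *)
Definition stochastic0 (p0 : B -> R) : Prop :=
  (forall v, 0 < p0 v) /\ \sum_v p0 v = 1.

Definition stochastic (P : B -> E -> R) : Prop :=
  (forall v e, 0 < P v e <-> src e = v) /\
  (forall v, \sum_(e | src e == v) P v e = 1).

(* In [P n v e] only n >= 1 is meaningful. *)
Definition markov_measure m (p0 : B -> R) (P : nat -> B -> E -> R) : Prop :=
  [/\ stochastic0 p0, forall n, (1 <= n)%N -> stochastic (P n) &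
   forall (v : B) (s : seq E), is_fpath v s ->
     m (cylinder v s) =
     (p0 v * \prod_(ie <- zip (iota 1 (size s)) s) P ie.1 (src ie.2) ie.2)%:E].

Definition stationary_markov m : Prop :=
  exists p0 P, markov_measure m p0 P /\ forall n, (1 <= n)%N -> P n = P 1%N.

Definition quasi_stationary_markov m : Prop :=
  exists p0 P, markov_measure m p0 P /\
    forall x : X, exists2 l : R, 0 < l &
      (fun n => \prod_(1 <= i < n.+1)
        (P i.+1 (src (pedge x i)) (pedge x i) / P i (src (pedge x i)) (pedge x i)))
        @ \oo --> l.

End measures.

Section radon_nikodym_sigma.
Variables (R : realType) (B : bratteli) (m : probability (path_space B) R).
Local Notation E := (edge B).
Local Notation X := (path_space B).
Variable e : E.

Local Open Scope ereal_scope.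

(* The measure m o sigma_e on [D_set e], extended by 0. *)
Definition m_sigma (C : set X) : \bar R := m (sigma e @` (C `&` D_set e)).

Lemma measurable_image_sigma (C : set X) :
  measurable C -> measurable (sigma e @` (C `&` D_set e)).
Proof.
move=> mC; rewrite image_sigma; apply: measurableI; last exact: measurable_R_set.
by rewrite -[X in measurable X]setTI; exact: measurable_coding.
Qed.

Local Lemma m_sigma0 : m_sigma set0 = 0.
Proof. by rewrite /m_sigma set0I image_set0 measure0. Qed.

Local Lemma m_sigma_ge0 C : 0 <= m_sigma C.
Proof. exact: measure_ge0. Qed.

Local Lemma m_sigma_sigma_additive : semi_sigma_additive m_sigma.
Proof.
move=> F mF tF mUF; rewrite /m_sigma setI_bigcupl image_bigcup.
apply: measure_semi_sigma_additive.
- by move=> n; exact: measurable_image_sigma.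
- apply/trivIsetP => i j _ _ ij; rewrite !image_sigma setIACA -preimage_setI.
  by move/trivIsetP : tF => /(_ i j Logic.I Logic.I ij) ->; rewrite preimage_set0 set0I.
- by apply: bigcup_measurable => n _; exact: measurable_image_sigma.
Qed.

HB.instance Definition _ := isMeasure.Build _ _ _ m_sigma
  m_sigma0 m_sigma_ge0 m_sigma_sigma_additive.

Local Lemma m_sigma_fin : fin_num_fun m_sigma.
Proof. by move=> C mC; apply: fin_num_measure; exact: measurable_image_sigma. Qed.

HB.instance Definition _ := @Measure_isFinite.Build _ _ _ m_sigma m_sigma_fin.

Definition rho (x : X) : R := fine ('d (charge_of_finite_measure m_sigma) '/d m x).

End radon_nikodym_sigma.

Section L2.
Context d (T : measurableType d) (R : realType) (mu : {measure set T -> \bar R}).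

Definition sqmod (z : R[i]) : R := complex.Re z ^+ 2 + complex.Im z ^+ 2.

Definition square_integrable (f : T -> R[i]) : Prop :=
  [/\ measurable_fun [set: T] (fun x => complex.Re (f x)),
      measurable_fun [set: T] (fun x => complex.Im (f x)) &
      (\int[mu]_x (sqmod (f x))%:E < +oo)%E].

Definition l2_pred : {pred T -> R[i]} := fun f => `[< square_integrable f >].

Lemma measurable_sqmod (f : T -> R[i]) :
  measurable_fun [set: T] (fun x => complex.Re (f x)) ->
  measurable_fun [set: T] (fun x => complex.Im (f x)) ->
  measurable_fun [set: T] (fun x => (sqmod (f x))%:E).
Proof.
by move=> mr mi; apply/measurable_EFinP/measurable_funD; exact: measurable_funX.
Qed.

Lemma sqmod_ge0 z : 0 <= sqmod z.
Proof. by rewrite addr_ge0 ?sqr_ge0. Qed.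

Lemma l2_pred_lin a : {in l2_pred &, forall f g, (fun x => a * f x + g x) \in l2_pred}.
Proof.
move=> f g /asboolP[frm fim fi] /asboolP[grm gim gi]; apply/asboolP.
have mr : measurable_fun [set: T] (fun x => complex.Re (a * f x + g x)).
  rewrite (_ : (fun x => _) = fun x => complex.Re a * complex.Re (f x)
    - complex.Im a * complex.Im (f x) + complex.Re (g x)); last first.
    by apply/funext => x; case: (f x) (g x) => [u v] [w z]; case: (a).
  apply: measurable_funD => //; apply: measurable_funB;
  exact: measurable_funM.
have mi : measurable_fun [set: T] (fun x => complex.Im (a * f x + g x)).
  rewrite (_ : (fun x => _) = fun x => complex.Re a * complex.Im (f x)
    + complex.Im a * complex.Re (f x) + complex.Im (g x)); last first.
    by apply/funext => x; case: (f x) (g x) => [u v] [w z]; case: (a).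
  apply: measurable_funD => //; apply: measurable_funD;
  exact: measurable_funM.
split=> //.
apply: (@le_lt_trans _ _ (\int[mu]_x ((2 * sqmod a)%:E * (sqmod (f x))%:E
   + 2%:E * (sqmod (g x))%:E))%E).
  apply: ge0_le_integral => //.
  - by move=> x _; rewrite lee_fin sqmod_ge0.
  - exact: measurable_sqmod.
  - by apply: emeasurable_funD; apply: emeasurable_funM => //; exact: measurable_sqmod.
  - move=> x _; rewrite -!EFinM -EFinD lee_fin.
    rewrite /sqmod; case: (f x) (g x) => [u v] [w z]; move: (a) => [b c] /=.
    have := sqr_ge0 (b * u - c * v - w).
    have := sqr_ge0 (b * v + c * u - z).
    by nra.
rewrite ge0_integralD//; last 4 first.
  - by move=> x _; rewrite -!EFinM lee_fin !mulr_ge0// sqmod_ge0.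
  - by apply: emeasurable_funM => //; exact: measurable_sqmod.
  - by move=> x _; rewrite -!EFinM lee_fin !mulr_ge0// sqmod_ge0.
  - by apply: emeasurable_funM => //; exact: measurable_sqmod.
rewrite !ge0_integralZl//; try (by move=> x _; rewrite lee_fin sqmod_ge0);
  try exact: measurable_sqmod; last first.
  by rewrite lee_fin mulr_ge0// sqmod_ge0.
by apply: lte_add_pinfty; apply: lte_mul_pinfty; rewrite ?lee_fin ?mulr_ge0 ?sqmod_ge0.
Qed.

Lemma l2_pred0 : 0 \in l2_pred.
Proof.
apply/asboolP; split=> /=; try exact: measurable_cst.
rewrite integral0_eq// => x _.
by rewrite /sqmod /= expr0n addr0.
Qed.

Record l2fun := L2fun { l2val :> T -> R[i]; _ : l2val \in l2_pred }.

HB.instance Definition _ := [isSub for l2val].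
HB.instance Definition _ := gen_eqMixin l2fun.
HB.instance Definition _ := gen_choiceMixin l2fun.

Lemma l2_pred_zmod : zmod_closed l2_pred.
Proof.
split; first exact: l2_pred0.
move=> f g fl gl; rewrite (_ : f - g = fun x => -1 * g x + f x).
  exact: l2_pred_lin.
by apply/funext => x; rewrite mulN1r addrC.
Qed.

HB.instance Definition _ :=
  GRing.isZmodClosed.Build (T -> R[i]) l2_pred l2_pred_zmod.
HB.instance Definition _ := [SubChoice_isSubZmodule of l2fun by <:].

Definition l2_null : {pred l2fun} :=
  fun f => `[< {ae mu, forall x, l2val f x = 0} >].

Lemma l2_null_zmod : zmod_closed l2_null.
Proof.
split; first by apply/asboolP; exact: aeW.
move=> f g /asboolP f0 /asboolP g0; apply/asboolP.
apply: filterS2 f0 g0 => x fx gx.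
by change (l2val f x - l2val g x = 0); rewrite fx gx subrr.
Qed.

HB.instance Definition _ := GRing.isZmodClosed.Build l2fun l2_null l2_null_zmod.

Definition L2 : Type := Quotient.quot l2_null.

HB.instance Definition _ := GRing.Zmodule.on L2.

Definition L2_repr (F : L2) : T -> R[i] := l2val (repr F).

(* The class of f; the value 0 for f not square-integrable is junk. *)
Definition L2_class (f : T -> R[i]) : L2 := \pi_L2 (insubd 0 f).

Lemma L2_repr_l2 F : L2_repr F \in l2_pred.
Proof. exact: (valP (repr F)). Qed.

Lemma L2_reprK F : L2_class (L2_repr F) = F.
Proof. by rewrite /L2_class /L2_repr valKd reprK. Qed.

Lemma L2_class_eq f g : f \in l2_pred -> g \in l2_pred ->
  {ae mu, forall x, f x = g x} -> L2_class f = L2_class g.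
Proof.
move=> fl gl fg; apply/eqP; rewrite -Quotient.idealrBE; apply/asboolP.
apply: filterS fg => x fgx.
change (l2val (insubd 0 f) x - l2val (insubd 0 g) x = 0).
by rewrite !insubdK// fgx subrr.
Qed.

Lemma L2_classK f : f \in l2_pred -> {ae mu, forall x, L2_repr (L2_class f) x = f x}.
Proof.
move=> fl; have /eqP := L2_reprK (L2_class f).
rewrite {1}/L2_class /L2_repr valKd -Quotient.idealrBE => /asboolP.
apply: filterS => x.
change (l2val (repr (L2_class f)) x - l2val (insubd 0 f) x = 0 ->
  l2val (repr (L2_class f)) x = f x).
by rewrite insubdK// => /eqP; rewrite subr_eq0 => /eqP.
Qed.

Lemma L2_classD f g : f \in l2_pred -> g \in l2_pred ->
  L2_class (fun x => f x + g x) = L2_class f + L2_class g.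
Proof.
move=> fl gl; rewrite /L2_class -pi_addr; congr (\pi_L2 _).
apply: val_inj; rewrite insubdK; last exact: (rpredD fl gl).
by rewrite /= !insubdK.
Qed.

Lemma l2_predZ a f : f \in l2_pred -> (fun x => a * f x) \in l2_pred.
Proof.
move=> fl; rewrite (_ : (fun x => _) = fun x => a * f x + (0 : T -> R[i]) x).
  exact: (l2_pred_lin a fl l2_pred0).
by apply/funext => x; rewrite addr0.
Qed.

Lemma l2_predD f g : f \in l2_pred -> g \in l2_pred ->
  (fun x => f x + g x) \in l2_pred.
Proof. by move=> fl gl; exact: (@rpredD _ l2_pred f g fl gl). Qed.

Definition L2_scale (a : R[i]) (F : L2) : L2 :=
  L2_class (fun x => a * L2_repr F x).

Lemma L2_repr_scale a F : {ae mu, forall x, L2_repr (L2_scale a F) x = a * L2_repr F x}.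
Proof. exact/L2_classK/l2_predZ/L2_repr_l2. Qed.

Lemma L2_repr_add F G :
  {ae mu, forall x, L2_repr (F + G) x = L2_repr F x + L2_repr G x}.
Proof.
have -> : F + G = L2_class (fun x => L2_repr F x + L2_repr G x).
  by rewrite L2_classD ?L2_reprK//; exact: L2_repr_l2.
by apply: L2_classK; apply: l2_predD; exact: L2_repr_l2.
Qed.

Lemma L2_eq F G : {ae mu, forall x, L2_repr F x = L2_repr G x} -> F = G.
Proof.
by move=> FG; rewrite -[F]L2_reprK -[G]L2_reprK; apply: L2_class_eq => //;
  exact: L2_repr_l2.
Qed.

Lemma L2_scaleA a b F : L2_scale a (L2_scale b F) = L2_scale (a * b) F.
Proof.
apply: L2_eq; move: (L2_repr_scale a (L2_scale b F)) (L2_repr_scale b F).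
apply: filterS3 (L2_repr_scale (a * b) F) => x -> -> ->.
by rewrite mulrA.
Qed.

Lemma L2_scale1 : left_id 1 L2_scale.
Proof.
by move=> F; apply: L2_eq; apply: filterS (L2_repr_scale 1 F) => x ->; rewrite mul1r.
Qed.

Lemma L2_scaleDr : right_distributive L2_scale +%R.
Proof.
move=> a F G; apply: L2_eq.
apply: filter_app (L2_repr_scale a (F + G)); apply: filter_app (L2_repr_add F G).
apply: filter_app (L2_repr_scale a F); apply: filter_app (L2_repr_scale a G).
apply: filterS (L2_repr_add (L2_scale a F) (L2_scale a G)) => x -> -> -> -> ->.
by rewrite mulrDr.
Qed.

Lemma L2_scaleDl F : {morph L2_scale^~ F : a b / a + b}.
Proof.
move=> a b /=; apply: L2_eq.
apply: filter_app (L2_repr_scale a F); apply: filter_app (L2_repr_scale b F).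
apply: filter_app (L2_repr_add (L2_scale a F) (L2_scale b F)).
apply: filterS (L2_repr_scale (a + b) F) => x -> -> -> ->.
by rewrite mulrDl.
Qed.

HB.instance Definition _ := GRing.Zmodule_isLmodule.Build R[i] L2
  L2_scaleA L2_scale1 L2_scaleDr L2_scaleDl.

Definition L2_inner (F G : L2) : R[i] :=
  (\int[mu]_x complex.Re (L2_repr F x * conjc (L2_repr G x))) +i*
  (\int[mu]_x complex.Im (L2_repr F x * conjc (L2_repr G x))).

End L2.

Section cuntz_krieger.
Variables (R : realType) (H : lmodType R[i]) (inner : H -> H -> R[i]).
Implicit Types S T : H -> H.

Definition hnorm (f : H) : R := Num.sqrt (complex.Re (inner f f)).

Definition bounded_linear T : Prop :=
  linear T /\ exists M : R, forall f, hnorm (T f) <= M * hnorm f.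

Definition is_adjoint T S : Prop := forall f g, inner (T f) g = inner f (S g).

Definition partial_isometry T : Prop :=
  forall f, (forall g, T g = 0 -> inner f g = 0) -> hnorm (T f) = hnorm f.

(* The family (S_i) generates a representation on H of the Cuntz-Krieger algebra
   of the 0-1 matrix [a]: by the universal property, this means that the S_i are
   partial isometries satisfying the defining relations. *)
Definition generates_CK_representation (I : finType) (a : rel I) (S : I -> H -> H)
    : Prop :=
  exists Sstar : I -> H -> H,
    [/\ forall i, bounded_linear (S i) /\ bounded_linear (Sstar i),
        forall i, is_adjoint (S i) (Sstar i),
        forall i, partial_isometry (S i),
        forall f, \sum_i S i (Sstar i f) = f &
        forall i f, Sstar i (S i f) = \sum_(j | a i j) S j (Sstar j f)].

End cuntz_krieger.

Section representation.
Variables (R : realType) (B : bratteli) (m : probability (path_space B) R).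
Local Notation E := (edge B).
Local Notation X := (path_space B).

Definition edge_adj : rel E := fun e f => tgt e == src f.

Definition T_tilde (e : E) (psi : L2 m) : L2 m :=
  L2_class m (fun x : X =>
    (\1_(R_set e) x * rho m e (coding x) `^ (- 2^-1))%:C * L2_repr psi (coding x)).

Definition T_tilde_star (e : E) (xi : L2 m) : L2 m :=
  L2_class m (fun x : X =>
    (\1_(D_set e) x * rho m e x `^ 2^-1)%:C * L2_repr xi (sigma e x)).

Definition T_vertex (i : B) (psi : L2 m) : L2 m :=
  \sum_(e : E | src e == i) T_tilde e psi.

End representation.

(* Main.v *)
Require Import Defs.
From mathcomp Require Import all_boot all_order all_algebra.
From mathcomp Require Import all_classical all_reals all_analysis.
From mathcomp Require Import measurable_realfun complex ring lra.

(* The finite measures m and m o sigma_e are compared on cylinders.  In each of the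
   three cases, along every path of D_e the ratio of their values on the cylinders
   shrinking to that path stays bounded above and below: for a quasi-stationary
   Markov measure it is a constant times the partial products of the convergent
   product; for a tail-invariant measure, primitivity lets one move, in a fixed
   number of steps, from any vertex to any other, so that a cylinder splits into
   boundedly many pieces each of which has the measure of a piece of the other
   cylinder.  Pointwise bounds suffice for mutual absolute continuity on D_e,
   hence rho_m > 0 almost everywhere on D_e.  The change of variables y = sigma_e(x)
   then makes T_e and T_e^* adjoint, with T_e^* T_e and T_e T_e^* the
   multiplications by the indicators of D_e and R_e, and T_e^* T_f = 0 for e <> f.

   For the vertices, T_e T_f^* = 0 as soon as r(e) <> r(f); since the matrix is 0-1,
   two distinct edges with the same source have distinct ranges, so the cross terms
   in T_i T_i^* and T_i^* T_i vanish and the relations for A follow from those for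
   the edge matrix by summing over the edges leaving i. *)

Set Implicit Arguments.
Unset Strict Implicit.
Unset Printing Implicit Defensive.

Import Order.TTheory GRing.Theory Num.Theory.
Import numFieldNormedType.Exports.

Local Open Scope classical_set_scope.
Local Open Scope ring_scope.

(** * Comparison of measures on the path space *)

Section prefixes.
Variable B : bratteli.
Local Notation E := (edge B).
Local Notation X := (path_space B).
Implicit Types (x y : X) (v w : B) (s t : seq E).

(** The codomain is a finite type, so cylinders are fibres of a map into a finite set and every
    union of fibres is a finite one. *)
Definition path_prefix n x : B * n.-tuple E :=
  (start x, [tuple of [seq pedge x i | i <- iota 1 n]]).

Lemma cylinder_prefix n v (t : n.-tuple E) :
  cylinder v t = @path_prefix n @^-1` [set (v, t)].
Proof.
rewrite /cylinder size_tuple.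
apply/seteqP; split=> x /= [sv xt]; last by rewrite -sv -xt.
by rewrite /path_prefix sv; congr (_, _); exact: val_inj.
Qed.

Lemma prefix_cylinder n x :
  @path_prefix n @^-1` [set path_prefix n x] =
  cylinder (start x) [seq pedge x i | i <- iota 1 n].
Proof. exact/esym/(@cylinder_prefix n _ (path_prefix n x).2). Qed.

Lemma prefix_pedge n x y i :
  path_prefix n x = path_prefix n y -> (i < n)%N -> pedge x i.+1 = pedge y i.+1.
Proof.
move=> [_ /(congr1 (fun s => nth (pedge x 1) s i))] + lt_in.
by rewrite !(nth_map 0%N) ?size_iota// !nth_iota// add1n.
Qed.

Lemma eq_prefix n x y : start x = start y ->
  (forall i, (i < n)%N -> pedge x i.+1 = pedge y i.+1) ->
  path_prefix n x = path_prefix n y.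
Proof.
move=> sxy xy; congr (_, _) => //; apply: val_inj => /=.
apply/eq_in_map => -[|i]; first by rewrite mem_iota.
by rewrite mem_iota add1n ltnS => /xy.
Qed.

Lemma prefix_le n k x y : (n <= k)%N ->
  path_prefix k x = path_prefix k y -> path_prefix n x = path_prefix n y.
Proof.
move=> nk xy; apply: eq_prefix => [|i lt_in]; first by case: xy.
by apply: prefix_pedge xy _; exact: leq_trans lt_in nk.
Qed.

Lemma is_fpath_cat v s t :
  is_fpath v (s ++ t) = is_fpath v s && is_fpath (fpath_end v s) t.
Proof. by elim: s v => //= e s ih v; rewrite ih andbA. Qed.

Lemma fpath_end_cat v s t :
  fpath_end v (s ++ t) = fpath_end (fpath_end v s) t.
Proof. by rewrite /fpath_end map_cat last_cat. Qed.

Lemma is_fpath_prefix n x :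
  is_fpath (start x) [seq pedge x i | i <- iota 1 n].
Proof.
have [p1 p2] := Defs.pathP x; rewrite -p1; case: n => //= n; rewrite eqxx /=.
have h k : is_fpath (tgt (pedge x k.+1)) [seq pedge x i | i <- iota k.+2 n].
  by elim: n k => //= n ih k; rewrite p2 eqxx ih.
exact: h 0.
Qed.

Lemma cylinder0 v s : ~~ is_fpath v s -> cylinder v s = set0.
Proof.
move=> vs; apply/seteqP; split=> // x [sx xs] /=.
by move: vs; rewrite -sx -xs is_fpath_prefix.
Qed.

Lemma measurable_cylinder v s : measurable (cylinder v s).
Proof.
have [vs|/cylinder0 ->] := boolP (is_fpath v s); last exact: measurable0.
by apply: sub_sigma_algebra; exact: open_cylinder.
Qed.

Lemma measurable_prefix n (S : set (B * n.-tuple E)) :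
  measurable (@path_prefix n @^-1` S).
Proof.
rewrite (_ : S = \bigcup_(p in S) [set p]); last first.
  by apply/seteqP; split=> [p Sp|p [q Sq ->]//]; exists p.
rewrite preimage_bigcup.
apply: fin_bigcup_measurable => [|[v t] _]; first exact: finite_finset.
by rewrite -cylinder_prefix; exact: measurable_cylinder.
Qed.

(** Finite disjoint unions of cylinders of one common length: the ring for the monotone class
    argument. *)
Definition prefix_sets : set (set X) :=
  [set A | exists n S, A = @path_prefix n @^-1` S].

Lemma prefix_setsP (A : set X) n :
  (forall x y, path_prefix n x = path_prefix n y -> A x -> A y) -> prefix_sets A.
Proof.
move=> An; exists n, (@path_prefix n @` A); apply/seteqP; split=> x /=.
  by move=> Ax; exists x.
by move=> [y Ay yx]; exact: An Ay.
Qed.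

Lemma prefix_setsE (A : set X) : prefix_sets A ->
  exists n, forall k x y, (n <= k)%N ->
    path_prefix k x = path_prefix k y -> A x -> A y.
Proof.
move=> [n [S ->]]; exists n => k x y nk xy /=.
by rewrite (prefix_le nk xy).
Qed.

Lemma setring_prefix_sets : setring prefix_sets.
Proof.
split.
- by apply: (@prefix_setsP _ 0).
- move=> A A' /prefix_setsE[n An] /prefix_setsE[k Ak].
  apply: (@prefix_setsP _ (maxn n k)) => x y xy [Ax|Ax]; [left|right].
    by apply: An xy Ax; exact: leq_maxl.
  by apply: Ak xy Ax; exact: leq_maxr.
- move=> A A' /prefix_setsE[n An] /prefix_setsE[k Ak].
  apply: (@prefix_setsP _ (maxn n k)) => x y xy [Ax A'x]; split.
    by apply: An xy Ax; exact: leq_maxl.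
  by move=> A'y; apply: A'x; apply: Ak (esym xy) A'y; exact: leq_maxr.
Qed.

(** A basic neighbourhood of [x] is a finite intersection of cylinders through [x], so it contains
    any sufficiently long one. *)
Lemma open_prefix (A : set X) x : open A -> A x ->
  exists n, forall y, path_prefix n x = path_prefix n y -> A y.
Proof.
move=> [F FI <-] [G FG Gx].
have [K KC GE] := FI _ FG.
suff [n nP] : exists n, forall y, path_prefix n x = path_prefix n y -> G y.
  by exists n => y /nP Gy; exists G.
move: Gx; rewrite -{}GE bigcap_fset.
rewrite big_seq; elim/big_ind: _ => [_|C C' ihC ihC' [/ihC[n nP] /ihC'[k kP]]|].
- by exists 0%N.
- exists (maxn n k) => y xy; split; [apply: nP|apply: kP];
    by apply: prefix_le xy; rewrite ?leq_maxl ?leq_maxr.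
- move=> C /KC; rewrite inE => -[v [s [_ ->]]] [sx xs].
  exists (size s) => y [sxy xy]; split; first by rewrite -sxy.
  by rewrite -xy.
Qed.

(** An open set is the union over [n] of the points whose cylinder of length [n] lies inside it, and
    each of these sets depends on the first [n] edges only. *)
Lemma measurable_sub_prefix_sigma_ring (A : set X) :
  measurable A -> <<sr prefix_sets>> A.
Proof.
have [sr0 srD srU] := @smallest_sigma_ring _ prefix_sets.
move: A; apply: smallest_sub.
  split=> // A srA; apply: srD => //; apply: sub_gen_smallest.
  by apply: (@prefix_setsP _ 0).
move=> A oA.
rewrite (_ : A = \bigcup_n
  [set x | forall y, path_prefix n x = path_prefix n y -> A y]).
  apply: srU => n; apply: sub_gen_smallest; apply: (@prefix_setsP _ n) => x y xy.
  by move=> /= Ax z yz; apply: Ax; rewrite xy.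
apply/seteqP; split=> [x /(open_prefix oA)[n nP]|x [n _]]; first by exists n.
by apply.
Qed.

(** The preimage of a prefix set of length [n] is the trace on [D] of one of length [k], and prefix
    sets generate the Borel sets. *)
Lemma measurable_fun_prefix (D : set X) (f : X -> X) : measurable D ->
  (forall n, exists k, forall x y, D x -> D y ->
    path_prefix k x = path_prefix k y ->
    path_prefix n (f x) = path_prefix n (f y)) ->
  measurable_fun D f.
Proof.
move=> mD fP; move=> _ A /measurable_sub_prefix_sigma_ring; move: A.
apply: smallest_sub.
  split.
  - by rewrite preimage_set0 setI0.
  - move=> A A' mA mA'.
    rewrite (_ : _ `&` _ = (D `&` f @^-1` A) `\` (D `&` f @^-1` A')).
      exact: measurableD.
    by apply/seteqP; split=> x /=; tauto.
  - by move=> A mA; rewrite preimage_bigcup setI_bigcupr; exact: bigcup_measurable.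
move=> _ [n [S ->]]; have [k kP] := fP n.
rewrite (_ : _ `&` _ = D `&` (@path_prefix k @^-1` (@path_prefix k @`
  (D `&` f @^-1` (@path_prefix n @^-1` S))))).
  by apply: measurableI => //; exact: measurable_prefix.
apply/seteqP; split=> [x [Dx Sx]|x [Dx [y [Dy Sy] yx]]]; split=> //=.
  by exists x.
by rewrite -(kP _ _ Dy Dx yx).
Qed.

End prefixes.

(** * Inequalities between finite measures, from cylinders to Borel sets *)

Section comparison.
Variables (R : realType) (B : bratteli).
Local Notation E := (edge B).
Local Notation X := (path_space B).
Implicit Types mu nu : {finite_measure set X -> \bar R}.
Local Open Scope ereal_scope.

(** Monotone class argument: additivity carries the inequality to finite disjoint unions of
    cylinders, continuity to monotone limits; finiteness allows the decreasing ones. *)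
Lemma le_measure_prefix mu nu :
  (forall n p,
    mu (@path_prefix B n @^-1` [set p]) <= nu (@path_prefix B n @^-1` [set p])) ->
  forall A, measurable A -> mu A <= nu A.
Proof.
move=> munu A mA.
suff : [set A | measurable A /\ mu A <= nu A] A by case.
apply: (monotone_setring_sub_g_sigma_ring _ (@setring_prefix_sets B)); last first.
- exact: measurable_sub_prefix_sigma_ring.
- move=> _ [n [S ->]]; split; first exact: measurable_prefix.
  rewrite (_ : S = \bigcup_(p in S) [set p]); last first.
    by apply/seteqP; split=> [p Sp|p [q Sq ->]//]; exists p.
  rewrite preimage_bigcup.
  have finS : finite_set S by exact: finite_finset.
  have trivS : trivIset S (fun p => @path_prefix B n @^-1` [set p]).
    by move=> p q _ _ [x [/= <- <-]].
  have mS p : S p -> measurable (@path_prefix B n @^-1` [set p]).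
    by move=> _; exact: measurable_prefix.
  rewrite !measure_fin_bigcup//.
  by apply: lee_fsum => // p _; exact: munu.
- split=> F Fm FG; have mF i : measurable (F i) by have [] := FG i.
  + have mU : measurable (\bigcup_i F i) by exact: bigcup_measurable.
    split=> //; apply: (lee_cvg_to (nondecreasing_cvg_mu mF mU Fm)
      (nondecreasing_cvg_mu mF mU Fm)).
    by apply: nearW => n; have [] := FG n.
  + have mI : measurable (\bigcap_i F i) by apply: bigcap_measurable.
    have oo (la : {finite_measure set X -> \bar R}) : la (F 0%N) < +oo.
      by rewrite -ge0_fin_numE// fin_num_measure.
    split=> //; apply: (lee_cvg_to (nonincreasing_cvg_mu (oo mu) mF mI Fm)
      (nonincreasing_cvg_mu (oo nu) mF mI Fm)).
    by apply: nearW => n; have [] := FG n.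
Qed.

(* On the set [M K] of the points where the bound holds with constant [K], the
   inequality [mu (A `&` M K) <= K * nu A] is checked on cylinders: a cylinder either
   misses [M K] or is itself one of the cylinders of a point of [M K]. *)
Lemma dominated_of_prefix mu nu (D : set X) : measurable D ->
  (forall x, D x -> exists K : R, forall n,
    mu (@path_prefix B n @^-1` [set path_prefix n x]) <=
    K%:E * nu (@path_prefix B n @^-1` [set path_prefix n x])) ->
  forall A, measurable A -> A `<=` D -> nu A = 0 -> mu A = 0.
Proof.
move=> mD DK A mA AD nuA.
pose M (K : nat) : set X := \bigcap_n (@path_prefix B n @^-1` [set p |
  mu (@path_prefix B n @^-1` [set p]) <=
  K%:R%:E * nu (@path_prefix B n @^-1` [set p])]).
have mM K : measurable (M K).
  by apply: bigcap_measurable => // n _; exact: measurable_prefix.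
have AM : A = \bigcup_K (A `&` M K).
  apply/seteqP; split=> [x Ax|x [K _ []]//].
  have [K Kx] := DK _ (AD _ Ax).
  exists (Num.truncn `|K|).+1 => //; split=> // n _ /=.
  rewrite (le_trans (Kx n))// lee_wpmul2r// lee_fin.
  by rewrite (le_trans (ler_norm K))// ltW// truncnS_gt.
have MK K : mu (A `&` M K) = 0.
  have K0 : (0 <= K%:R :> R)%R by exact: ler0n.
  apply/eqP; rewrite -measure_le0 (le_trans (_ : _ <= mscale (NngNum K0) nu A))//.
    apply: (@le_measure_prefix (mrestr mu (mM K)) (mscale (NngNum K0) nu)) => //.
    move=> n p.
    have [[x <- Mx]|xp] := pselect (exists2 x, path_prefix n x = p & M K x).
      apply: (le_trans _ (Mx n Logic.I)); apply: measureIl => //.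
      exact: measurable_prefix.
    rewrite [leLHS](_ : _ = 0) ?measure_ge0//; apply: (etrans _ (measure0 mu)).
    congr (mu _); apply/seteqP; split=> // y [yp My]; apply: xp.
    by exists y.
  by rewrite /mscale /= nuA mule0.
rewrite AM; apply/negligibleP.
  by apply: bigcup_measurable => K _; exact: measurableI.
by apply: negligible_bigcup => K; apply/negligibleP; [exact: measurableI|exact: MK].
Qed.
End comparison.

(** * Cylinder ratios for the three classes of measures *)

Section equivalence.
Variables (R : realType) (B : bratteli) (m : probability (path_space B) R).
Local Notation E := (edge B).
Local Notation X := (path_space B).
Implicit Types (x y : X) (v w : B) (s t : seq E) (e : E).

(** A positive entry of the [j]-th power of the matrix witnesses a path of [j] edges; primitivity
    gives one length [k] joining every pair of vertices. *)
Lemma has_path : exists k, forall v w, exists t,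
  [/\ is_fpath v t, size t = k & fpath_end v t = w].
Proof.
have [k [_ Ak]] := adj_primitive B; exists k.
suff h j (a b : 'I_#|B|) : (0 < (adj_matrix (@adj B) ^+ j)%R a b)%N ->
    exists t, [/\ is_fpath (enum_val a) t, size t = j &
      fpath_end (enum_val a) t = enum_val b].
  move=> v w; have [t tP] := h k (enum_rank v) (enum_rank w) (Ak _ _).
  by exists t; rewrite !enum_rankK in tP.
elim: j a => [|j ih] a.
  rewrite expr0 mxE; case: eqP => [->|//] _.
  by exists [::].
rewrite exprS mxE lt0n sum_nat_eq0 => /forallPn /= [c].
rewrite muln_eq0 negb_or !mxE => /andP[]; case: (boolP (adj _ _)) => // al _.
rewrite -lt0n => /ih[t [vt st et]].
by exists (exist _ (enum_val a, enum_val c) al :: t); rewrite /= eqxx st.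
Qed.

Lemma image_sigma_cylinder e s :
  sigma e @` (cylinder (tgt e) s `&` D_set e) = cylinder (src e) (e :: s).
Proof.
rewrite image_sigma; apply/seteqP.
have cE x n : [seq pedge (coding x) i | i <- iota 1 n] =
              [seq pedge x i | i <- iota 2 n].
  rewrite (iotaDl 1 1) -map_comp; apply/eq_in_map => -[|i] //.
  by rewrite mem_iota.
split=> x /=.
  move=> [[sx xs] Rx]; split => /=; last by rewrite Rx -cE xs.
  by have [<- _] := Defs.pathP x; rewrite Rx.
move=> [sx [xe xs]]; split => //; split; last by rewrite cE.
by have [_ /(_ 0%N)] := Defs.pathP x; rewrite xe.
Qed.

Local Open Scope ereal_scope.

(** The cylinder is covered by its extensions by [j] edges. Counting all [j]-tuples is harmless,
    since those that do not continue the path give empty cylinders. *)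
Lemma le_measure_extensions v s j (c : \bar R) : 0 <= c ->
  (forall t, size t = j -> is_fpath v (s ++ t) -> m (cylinder v (s ++ t)) <= c) ->
  m (cylinder v s) <= (#|{: j.-tuple E}|%:R)%:E * c.
Proof.
move=> c0 mc.
have sum_c (r : seq (j.-tuple E)) : \sum_(t <- r) c = (size r)%:R%:E * c.
  elim: r => [|t r ih]; first by rewrite big_nil mul0e.
  by rewrite big_cons ih /= -natr1 EFinD ge0_muleDl// mul1e addeC.
rewrite cardE -sum_c.
apply: (@le_trans _ _ (\sum_(t <- enum {: j.-tuple E}) m (cylinder v (s ++ t)))).
  rewrite fsbig_seq ?enum_uniq//; apply: content_sub_fsum => //.
  - by move=> t _; exact: measurable_cylinder.
  - exact: measurable_cylinder.
  - move=> x [xv xs].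
    exists [tuple of [seq pedge x i | i <- iota (size s).+1 j]].
      by rewrite /= mem_enum.
    split=> //=.
    by rewrite size_cat size_map size_iota iotaD map_cat xs add1n.
apply: lee_sum => t _.
have [vst|/cylinder0 ->] := boolP (is_fpath v (s ++ t)); last by rewrite measure0.
by apply: mc => //; rewrite size_tuple.
Qed.

Lemma le_cylinder_cat v s t : m (cylinder v (s ++ t)) <= m (cylinder v s).
Proof.
apply: le_measure; rewrite ?inE; [exact: measurable_cylinder..|].
move=> x [xv]; rewrite size_cat iotaD map_cat => /eqP.
by rewrite eqseq_cat ?size_map ?size_iota// => /andP[/eqP xs _].
Qed.

(** The constant depends on the path but not on the length: the quasi-stationary condition controls
    its product only path by path. *)
Definition comparable_prefixes e := forall x, D_set e x -> exists K : R,
  forall n,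
    m_sigma m e (@path_prefix B n @^-1` [set path_prefix n x]) <=
      K%:E * m (@path_prefix B n @^-1` [set path_prefix n x]) /\
    m (@path_prefix B n @^-1` [set path_prefix n x]) <=
      K%:E * m_sigma m e (@path_prefix B n @^-1` [set path_prefix n x]).

Lemma D_set_start e x : D_set e x -> start x = tgt e.
Proof. by have [<- _] := Defs.pathP x. Qed.

Lemma m_sigma_prefix e x n : D_set e x ->
  m_sigma m e (@path_prefix B n @^-1` [set path_prefix n x]) =
  m (cylinder (src e) (e :: [seq pedge x i | i <- iota 1 n])).
Proof.
move=> Dx.
by rewrite /m_sigma prefix_cylinder (D_set_start Dx) image_sigma_cylinder.
Qed.

(** Both cylinders are refined to the common length [n + k + 1]. Each piece of one is matched with a
    sub-cylinder of the other having the same length and end, and tail invariance equates their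
    measures. *)
Lemma tail_invariant_comparable e : tail_invariant m -> comparable_prefixes e.
Proof.
move=> tm x Dx; have [k kP] := has_path.
pose K : R := (#|{: k.-tuple E}|%:R + #|{: k.+1.-tuple E}|%:R)%R.
exists K => n; rewrite m_sigma_prefix// prefix_cylinder (D_set_start Dx).
have := is_fpath_prefix n x; rewrite (D_set_start Dx).
set s := [seq _ | _ <- _] => vs.
have sn : size s = n by rewrite size_map size_iota.
split.
- apply: (@le_trans _ _ ((#|{: k.-tuple E}|%:R)%:E *
      m (cylinder (tgt e) s))); last first.
    by rewrite lee_wpmul2r// lee_fin lerDl ler0n.
  apply: le_measure_extensions => // t st /= /andP[_ vst].
  (* An arbitrary edge [f] makes up for the missing [e]; [k] more edges then reach the required
     end. *)
  have [f sf] := has_out_edge (fpath_end (tgt e) s).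
  have [t' [ft' st' et']] := kP (tgt f) (fpath_end (tgt e) (s ++ t)).
  rewrite (tm (src e) (tgt e) (e :: (s ++ t)) (s ++ f :: t')) ?le_cylinder_cat//=.
  + by rewrite eqxx.
  + by rewrite is_fpath_cat vs /= sf eqxx.
  + by rewrite !size_cat /= st st' addnS.
  + by rewrite [RHS]fpath_end_cat.
- apply: (@le_trans _ _ ((#|{: k.+1.-tuple E}|%:R)%:E *
      m (cylinder (src e) (e :: s)))); last first.
    by rewrite lee_wpmul2r// lee_fin lerDr ler0n.
  (* Here [k + 1] edges are added, against [k] on the side that already contains [e]. *)
  apply: le_measure_extensions => // t st vst.
  have [t' [ft' st' et']] := kP (fpath_end (tgt e) s) (fpath_end (tgt e) (s ++ t)).
  rewrite (tm (tgt e) (src e) (s ++ t) ((e :: s) ++ t')) ?le_cylinder_cat//=.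
  + by rewrite eqxx is_fpath_cat vs.
  + by rewrite !size_cat /= st st' addnS.
  + by rewrite -[RHS]/(fpath_end (tgt e) (s ++ t')) fpath_end_cat et'.
Qed.

Lemma markov_prefix p0 P x n : markov_measure m p0 P ->
  m (@path_prefix B n @^-1` [set path_prefix n x]) =
  (p0 (start x) * \prod_(1 <= i < n.+1) P i (src (pedge x i)) (pedge x i))%:E.
Proof.
move=> [_ _ mE]; rewrite prefix_cylinder mE ?is_fpath_prefix// size_map size_iota.
by rewrite -[X in zip X]map_id zip_map big_map /index_iota subn1.
Qed.

(** Prepending [e] moves every later edge one level down, so the ratio of the two measures is a
    constant times the partial product [b n / a n] of the quasi-stationary condition. Its limit is
    finite and positive, so it and its inverse are bounded. *)
Lemma quasi_stationary_comparable e :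
  quasi_stationary_markov m -> comparable_prefixes e.
Proof.
move=> [p0 [P [mk qs]]] x Dx.
have [[p0_gt0 _] sP mE] := mk.
have [l l0 Gl] := qs x.
pose a n : R := (\prod_(1 <= i < n.+1) P i (src (pedge x i)) (pedge x i))%R.
pose b n : R := (\prod_(1 <= i < n.+1) P i.+1 (src (pedge x i)) (pedge x i))%R.
have P0 i f : (1 <= i)%N -> (0 < P i (src f) f)%R.
  by move=> i1; have [h _] := sP i i1; exact/h.
have a0 n : (0 < a n)%R.
  by rewrite /a big_nat_cond prodr_gt0// => i /andP[/andP[i1 _] _]; exact: P0.
have b0 n : (0 < b n)%R.
  by rewrite /b big_nat_cond prodr_gt0// => i _; exact: P0.
have {}Gl : (b n / a n)%R @[n --> \oo] --> l.
  apply: cvg_trans Gl; apply: near_eq_cvg; apply: nearW => n.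
  by rewrite /a /b prodf_div.
have mxE n : m (@path_prefix B n @^-1` [set path_prefix n x]) =
    (p0 (tgt e) * a n)%:E.
  by rewrite -(D_set_start Dx) -markov_prefix.
have msE n : m_sigma m e (@path_prefix B n @^-1` [set path_prefix n x]) =
    (p0 (src e) * P 1%N (src e) e * b n)%:E.
  rewrite m_sigma_prefix// mE; last first.
    by rewrite /= eqxx -(D_set_start Dx) is_fpath_prefix.
  rewrite /= size_map size_iota big_cons -mulrA (iotaDl 1 1) zip_map.
  by rewrite big_map /b /index_iota subn1.
have [M [_ MP]] := cvg_seq_bounded (cvgP _ Gl).
have [N [_ NP]] := cvg_seq_bounded (cvgP _ (cvgV (lt0r_neq0 l0) Gl)).
(* The part of the ratio that does not depend on [n]. *)
pose c := (p0 (src e) * P 1%N (src e) e / p0 (tgt e))%R.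
have c0 : (0 < c)%R by rewrite !mulr_gt0 ?invr_gt0// P0.
(* Every number above [M], respectively [N], is a bound, hence the added 1; the sum of two
   nonnegative constants serves both inequalities. *)
exists (c * (`|M| + 1) + c^-1 * (`|N| + 1))%R => n.
rewrite mxE msE -!EFinM !lee_fin.
have {}MP : (b n / a n <= `|M| + 1)%R.
  rewrite (le_trans (ler_norm _))// MP//.
  by rewrite (le_lt_trans (ler_norm _))// ltrDl.
have {}NP : (a n / b n <= `|N| + 1)%R.
  rewrite -invf_div (le_trans (ler_norm _))// NP//.
  by rewrite (le_lt_trans (ler_norm _))// ltrDl.
have pt := p0_gt0 (tgt e).
split.
- rewrite (_ : _ * b n = c * (b n / a n) * (p0 (tgt e) * a n))%R; last first.
    by rewrite /c; field; rewrite !gt_eqF.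
  apply: ler_wpM2r; first by rewrite mulr_ge0// ltW.
  apply: (@le_trans _ _ (c * (`|M| + 1))%R); first by rewrite ler_wpM2l// ltW.
  by rewrite lerDl mulr_ge0 ?invr_ge0 ?addr_ge0// ltW.
- rewrite (_ : _ * a n = c^-1 * (a n / b n) *
      (p0 (src e) * P 1%N (src e) e * b n))%R; last first.
    by rewrite /c; field; rewrite !gt_eqF// P0.
  apply: ler_wpM2r; first by rewrite !mulr_ge0// ltW// P0.
  apply: (@le_trans _ _ (c^-1 * (`|N| + 1))%R).
    by rewrite ler_wpM2l// invr_ge0 ltW.
  by rewrite lerDr mulr_ge0 ?addr_ge0// ltW.
Qed.

Lemma stationary_quasi_stationary :
  stationary_markov m -> quasi_stationary_markov m.
Proof.
move=> [p0 [P [mk PE]]]; exists p0, P; split=> // x; exists 1%R => //.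
have [_ sP _] := mk.
apply: cvg_near_cst; apply: nearW => n.
rewrite big_nat_cond big1// => i /andP[/andP[i1 _] _].
rewrite (PE _ i1) (PE i.+1)// divff// gt_eqF//.
by have [h _] := sP 1%N isT; exact/h.
Qed.

Lemma measurable_D_set e : measurable (D_set (B := B) e).
Proof.
rewrite (_ : D_set e = cylinder (tgt e) [::]); first exact: measurable_cylinder.
apply/seteqP; split=> [x /D_set_start|x [xe _]] //=.
by rewrite /D_set /= -xe; have [] := Defs.pathP x.
Qed.

Lemma m_sigma_D e (A : set X) : m_sigma m e A = m_sigma m e (A `&` D_set e).
Proof. by rewrite /m_sigma -setIA setIid. Qed.

(** * Mutual absolute continuity on [D_set e] *)

Section absolute_continuity.
Variable e : E.
Hypothesis cmp : comparable_prefixes e.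

(** [m_sigma] is carried by [D_set e], so only the part of a null set inside [D_set e] matters, and
    there the cylinder bounds apply. *)
Lemma m_sigma_dominated : m_sigma m e `<< m.
Proof.
apply/null_content_dominatesP => A mA A0.
have mD := measurable_D_set e.
rewrite m_sigma_D; apply: (@dominated_of_prefix _ _ _ m _ mD) => //.
- by move=> x /cmp[K KP]; exists K => n; have [] := KP n.
- exact: measurableI.
- by apply: (@subset_measure0 _ _ _ m _ A) => //; exact: measurableI.
Qed.

Lemma dominated_m_sigma (A : set X) : measurable A -> A `<=` D_set e ->
  m_sigma m e A = 0 -> m A = 0.
Proof.
have mD := measurable_D_set e.
apply: (@dominated_of_prefix _ _ m _ _ mD).
by move=> x /cmp[K KP]; exists K => n; have [] := KP n.
Qed.

End absolute_continuity.

Lemma comparable_prefixesP e :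
  tail_invariant m \/ stationary_markov m \/ quasi_stationary_markov m ->
  comparable_prefixes e.
Proof.
move=> [|[/stationary_quasi_stationary|]].
- exact: tail_invariant_comparable.
- exact: quasi_stationary_comparable.
- exact: quasi_stationary_comparable.
Qed.

End equivalence.

(** * The Radon-Nikodym derivative and the change of variables *)

Section change_of_variables.
Variables (R : realType) (B : bratteli) (m : probability (path_space B) R).
Local Notation E := (edge B).
Local Notation X := (path_space B).
Variable e : E.
Implicit Types (x y : X).

Lemma codingK x : R_set e x -> sigma e (coding x) = x.
Proof.
move=> Rx; have [p1 p2] := Defs.pathP x.
have Dx : D_set e (coding x) by rewrite /D_set /= -Rx; exact: p2 0%N.
apply: path_eq => [|[|i]]; rewrite /start /pedge sigma_val//=.
by rewrite -Rx p1.
Qed.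

Lemma D_set_coding x : R_set e x -> D_set e (coding x).
Proof. by move=> Rx; rewrite /D_set /= -Rx; have [_ /(_ 0%N)] := Defs.pathP x. Qed.

Lemma sigmaK y : D_set e y -> coding (sigma e y) = y.
Proof.
move=> Dy; have [p1 p2] := Defs.pathP y.
apply: path_eq => [|i]; last by rewrite {1}/pedge /= /pedge sigma_val.
by rewrite {1}/start /= /pedge sigma_val //=.
Qed.

Lemma R_set_sigma y : D_set e y -> R_set e (sigma e y).
Proof. by move=> Dy; rewrite /R_set /= /pedge sigma_val. Qed.

Lemma measurable_sigma : measurable_fun [set: X] (sigma e).
Proof.
have mD := @measurable_D_set B e.
rewrite -(setUv (D_set e)); apply/measurable_funU => //; first exact: measurableC.
split.
  apply: measurable_fun_prefix => // n; exists n => x y Dx Dy xy.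
  apply: eq_prefix => [|i lt_in]; rewrite /start /pedge !sigma_val//=.
  case: i lt_in => //= i lt_in.
  by apply: prefix_pedge xy _; exact: leq_trans lt_in.
(* Off [D_set e] the default value of [insubd] makes [sigma e] the identity. *)
apply: (eq_measurable_fun id) => [y|]; last exact: measurable_id.
rewrite inE => Dy; rewrite /sigma /insubd insubN//.
apply/asboolP => -[/= _ /(_ 0%N)] h; apply: Dy.
exact: h.
Qed.

Hypothesis cmp : comparable_prefixes m e.
Local Notation r := (rho m e).

Local Open Scope ereal_scope.

Lemma measurable_rho : measurable_fun [set: X] r.
Proof.
apply: measurableT_comp => //.
apply: measurable_int; apply: Radon_Nikodym_integrable.
exact: m_sigma_dominated.
Qed.

Local Notation nu :=
  (charge_of_finite_measure (m_sigma m e) : {charge set X -> \bar R}).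

Lemma rhoE x : (r x)%:E = Radon_Nikodym nu m x.
Proof. by rewrite fineK// Radon_Nikodym_fin_num//; exact: m_sigma_dominated. Qed.

Lemma m_sigma_integral (A : set X) : measurable A ->
  m_sigma m e A = \int[m]_(x in A) (r x)%:E.
Proof.
move=> mA; under eq_integral do rewrite rhoE.
exact: (@Radon_Nikodym_integral _ _ _ nu m A (m_sigma_dominated cmp) mA).
Qed.

(** The part of [D_set e] where the density is nonpositive has [m_sigma] measure at most 0, hence is
    [m]-null by the reverse domination. *)
Lemma rho_gt0 : {ae m, forall x, D_set e x -> (0 < r x)%R}.
Proof.
pose Z := D_set e `&` [set x | (r x <= 0)%R].
have mZ : measurable Z.
  apply: measurableI; first exact: measurable_D_set.
  rewrite (_ : mkset _ = setT `&` r @^-1` `]-oo, 0%R]).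
    exact: measurable_rho.
  by apply/seteqP; split=> x /=; rewrite in_itv/= => // -[].
have ZD : Z `<=` D_set e by move=> x [].
exists Z; split=> //; last first.
  move=> x /= /not_implyP[Dx /negP]; rewrite -leNgt => rx.
  by split.
apply: (dominated_m_sigma cmp) => //.
suff : m_sigma m e Z <= 0 by rewrite measure_le0 => /eqP.
rewrite m_sigma_integral//.
have Z0 x : Z x -> 0 <= - (r x)%:E by move=> [_ rx]; rewrite oppe_ge0 lee_fin.
rewrite (eq_integral (fun x => - (- (r x)%:E))); last first.
  by move=> x _; rewrite oppeK.
rewrite integral_ge0N// oppe_le0.
exact: integral_ge0.
Qed.

(** On [R_set e], [coding] inverts [sigma e], so there [m] is the image of [m_sigma] under
    [sigma e]. *)
Lemma m_sigma_sigma (A : set X) : measurable A -> A `<=` R_set e ->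
  m A = m_sigma m e (sigma e @^-1` A).
Proof.
move=> mA AR; rewrite /m_sigma; congr (m _); apply/seteqP; split=> x /=.
  move=> Ax; exists (coding x); last by rewrite codingK//; exact: AR.
  by rewrite /= codingK; [split=> //; exact/D_set_coding/AR|exact: AR].
by move=> [y [Ay Dy] <-].
Qed.

(* [rho] is only known to be nonnegative almost everywhere on [D_set e], whence the
   absolute value, which keeps the integrand nonnegative everywhere. *)
Lemma ge0_integral_sigma (g : X -> \bar R) : measurable_fun [set: X] g ->
  (forall x, 0 <= g x) ->
  \int[m]_(x in R_set e) g x =
  \int[m]_(x in D_set e) (g (sigma e x) * `|r x|%:E).
Proof.
move=> mg g0.
have mR := @measurable_R_set B e; have mD := @measurable_D_set B e.
have ms := measurable_sigma.
have mgs : measurable_fun [set: X] (g \o sigma e) by exact: measurableT_comp.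
rewrite (eq_measure_integral (pushforward (m_sigma m e) (sigma e))); last first.
  by move=> A mA AR; exact: m_sigma_sigma.
rewrite ge0_integral_pushforward//; last exact: measurable_funTS.
have mC := measurableC mD.
have mpre : measurable (sigma e @^-1` R_set e).
  by rewrite -[X in measurable X]setTI; exact: ms.
(* A point off [D_set e] is fixed by [sigma e] and may lie in [R_set e]; such points are
   [m_sigma]-null and are discarded. *)
rewrite (ge0_negligible_integral mC)//; last 3 first.
- exact: measurable_funTS.
- by move=> x _; exact: g0.
- have : m_sigma m e (~` D_set e) = 0; last by [].
  by rewrite /m_sigma setICl image_set0 measure0.
rewrite setDE setCK setIidr; last by move=> x Dx; exact: R_set_sigma.
have dom := m_sigma_dominated cmp.
rewrite -(Radon_Nikodym_SigmaFinite.change_of_variables dom)//=; last first.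
  exact: measurable_funTS.
apply: ae_eq_integral => //.
- apply: measurable_funTS; apply: emeasurable_funM => //.
  exact: measurable_int (Radon_Nikodym_SigmaFinite.f_integrable dom).
- apply: measurable_funTS; apply: emeasurable_funM => //.
  apply/measurable_EFinP; apply: measurableT_comp => //.
  exact: measurable_rho.
(* The density in the change of variables and [rho] are two choices of the derivative, equal almost
   everywhere; positivity removes the absolute value. *)
have := ae_eq_Radon_Nikodym_SigmaFinite dom mD.
apply: filterS2 rho_gt0 => x r0 h Dx; rewrite gtr0_norm ?r0// rhoE; congr (_ * _).
exact: h.
Qed.

End change_of_variables.

(** * The inner product of L2 *)

Section complex_scaling.
Local Open Scope complex_scope.
Variable R : realType.
Implicit Types (a : R) (z : R[i]).

Lemma Re_scale a z : complex.Re (a%:C * z) = a * complex.Re z.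
Proof. by case: z => b c /=; rewrite mul0r subr0. Qed.

Lemma Im_scale a z : complex.Im (a%:C * z) = a * complex.Im z.
Proof. by case: z => b c /=; rewrite mul0r addr0. Qed.

Lemma sqmod_scale a z : sqmod (a%:C * z) = a ^+ 2 * sqmod z.
Proof. by rewrite /sqmod Re_scale Im_scale !exprMn mulrDr. Qed.

Lemma conjc_scale a z : conjc (a%:C * z) = a%:C * conjc z.
Proof. by rewrite rmorphM /= oppr0. Qed.

End complex_scaling.

Section square_integrable_functions.
Local Open Scope complex_scope.
Context d (T : measurableType d) (R : realType) (mu : {measure set T -> \bar R}).
Implicit Types (f g : T -> R[i]) (F G : L2 mu).

Lemma measurable_Re_conj f g : f \in l2_pred mu -> g \in l2_pred mu ->
  measurable_fun [set: T] (fun x => complex.Re (f x * conjc (g x))).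
Proof.
move=> /asboolP[fr fi _] /asboolP[gr gi _].
rewrite (_ : (fun x => _) = fun x => complex.Re (f x) * complex.Re (g x) +
  complex.Im (f x) * complex.Im (g x)).
  by apply: measurable_funD; exact: measurable_funM.
by apply/funext => x; case: (f x) (g x) => [a b] [c e] /=; rewrite mulrN opprK.
Qed.

Lemma measurable_Im_conj f g : f \in l2_pred mu -> g \in l2_pred mu ->
  measurable_fun [set: T] (fun x => complex.Im (f x * conjc (g x))).
Proof.
move=> /asboolP[fr fi _] /asboolP[gr gi _].
rewrite (_ : (fun x => _) = fun x => complex.Im (f x) * complex.Re (g x) -
  complex.Re (f x) * complex.Im (g x)).
  by apply: measurable_funB; exact: measurable_funM.
by apply/funext => x; case: (f x) (g x) => [a b] [c e] /=; ring.
Qed.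

Lemma integrable_dominated_sqmod f g (h : T -> R) :
  f \in l2_pred mu -> g \in l2_pred mu -> measurable_fun [set: T] h ->
  (forall x, `|h x| <= sqmod (f x) + sqmod (g x)) ->
  mu.-integrable [set: T] (EFin \o h).
Proof.
move=> /asboolP[fr fi foo] /asboolP[gr gi goo] mh hfg.
have sq_int k : measurable_fun [set: T] (fun x => complex.Re (k x)) ->
    measurable_fun [set: T] (fun x => complex.Im (k x)) ->
    (\int[mu]_x (sqmod (k x))%:E < +oo)%E ->
    mu.-integrable [set: T] (EFin \o (fun x => sqmod (k x))).
  move=> kr ki koo; apply/integrableP; split; first exact: measurable_sqmod.
  by under eq_integral do rewrite /= ger0_norm ?sqmod_ge0//.
apply: (le_integrable _ _ _
  (integrableD _ (sq_int f fr fi foo) (sq_int g gr gi goo))) => //.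
  exact/measurable_EFinP.
move=> x _; rewrite /= lee_fin [leRHS]ger0_norm//.
by rewrite addr_ge0 ?sqmod_ge0.
Qed.

Lemma integrable_Re_conj f g : f \in l2_pred mu -> g \in l2_pred mu ->
  mu.-integrable [set: T] (EFin \o (fun x => complex.Re (f x * conjc (g x)))).
Proof.
move=> fl gl; apply: (integrable_dominated_sqmod fl gl).
  exact: measurable_Re_conj.
move=> x; rewrite /sqmod; case: (f x) (g x) => [a b] [c e] /=.
(* Twice a product is at most the sum of the squares; sums and differences cover both signs. *)
have := (sqr_ge0 (a + c), sqr_ge0 (a - c), sqr_ge0 (b + e), sqr_ge0 (b - e)).
have := (sqr_ge0 a, sqr_ge0 b, sqr_ge0 c, sqr_ge0 e).
rewrite !expr2 => -[[[? ?] ?] ?] [[[? ?] ?] ?].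
by rewrite ler_norml; apply/andP; split; lra.
Qed.

Lemma integrable_Im_conj f g : f \in l2_pred mu -> g \in l2_pred mu ->
  mu.-integrable [set: T] (EFin \o (fun x => complex.Im (f x * conjc (g x)))).
Proof.
move=> fl gl; apply: (integrable_dominated_sqmod fl gl).
  exact: measurable_Im_conj.
move=> x; rewrite /sqmod; case: (f x) (g x) => [a b] [c e] /=.
have := (sqr_ge0 (a + e), sqr_ge0 (a - e), sqr_ge0 (b + c), sqr_ge0 (b - c)).
have := (sqr_ge0 a, sqr_ge0 b, sqr_ge0 c, sqr_ge0 e).
rewrite !expr2 => -[[[? ?] ?] ?] [[[? ?] ?] ?].
by rewrite ler_norml; apply/andP; split; lra.
Qed.

Lemma eq_Rintegral_ae (h k : T -> R) : measurable_fun [set: T] h ->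
  measurable_fun [set: T] k -> {ae mu, forall x, h x = k x} ->
  (\int[mu]_x h x = \int[mu]_x k x)%R.
Proof.
move=> mh mk hk; congr fine; apply: ae_eq_integral => //.
- exact/measurable_EFinP.
- exact/measurable_EFinP.
- by apply: filterS hk => x -> _.
Qed.

(** The inner product is defined through chosen representatives; this allows any square-integrable
    representatives. *)
Lemma L2_innerE F G f g : f \in l2_pred mu -> g \in l2_pred mu ->
  {ae mu, forall x, L2_repr F x = f x} -> {ae mu, forall x, L2_repr G x = g x} ->
  L2_inner F G = (\int[mu]_x complex.Re (f x * conjc (g x))) +i*
    (\int[mu]_x complex.Im (f x * conjc (g x))).
Proof.
move=> fl gl Ff Gg; have Fl := L2_repr_l2 F; have Gl := L2_repr_l2 G.
congr (_ +i* _); apply: eq_Rintegral_ae.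
- exact: measurable_Re_conj.
- exact: measurable_Re_conj.
- by apply: filterS2 Ff Gg => x -> ->.
- exact: measurable_Im_conj.
- exact: measurable_Im_conj.
- by apply: filterS2 Ff Gg => x -> ->.
Qed.

Lemma L2_innerDl F G (K : L2 mu) :
  L2_inner (F + G) K = L2_inner F K + L2_inner G K.
Proof.
have Fl := L2_repr_l2 F; have Gl := L2_repr_l2 G; have Kl := L2_repr_l2 K.
have FGl := l2_predD Fl Gl.
rewrite (L2_innerE FGl Kl (L2_repr_add F G) (aeW _ (fun _ => erefl))).
have addcE (a b c e : R) : (a +i* b) + (c +i* e) = (a + c) +i* (b + e) by [].
rewrite addcE; congr (_ +i* _); rewrite -RintegralD//.
- by apply: eq_Rintegral => x _; rewrite mulrDl raddfD.
- exact: integrable_Re_conj.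
- exact: integrable_Re_conj.
- by apply: eq_Rintegral => x _; rewrite mulrDl raddfD.
- exact: integrable_Im_conj.
- exact: integrable_Im_conj.
Qed.

Lemma L2_innerC F G : L2_inner G F = conjc (L2_inner F G).
Proof.
have Fl := L2_repr_l2 F; have Gl := L2_repr_l2 G.
rewrite /L2_inner /=; congr (_ +i* _).
  apply: eq_Rintegral => x _.
  by case: (L2_repr F x) (L2_repr G x) => [a b] [c e] /=; ring.
rewrite -mulN1r -RintegralZl//; last exact: integrable_Im_conj.
apply: eq_Rintegral => x _.
by case: (L2_repr F x) (L2_repr G x) => [a b] [c e] /=; ring.
Qed.

Lemma L2_inner_ge0 F : 0 <= complex.Re (L2_inner F F).
Proof.
apply: Rintegral_ge0 => x _; case: (L2_repr F x) => a b /=.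
by rewrite mulrN opprK addr_ge0// -expr2 sqr_ge0.
Qed.

Lemma L2_repr_sum (I : Type) (s : seq I) (P : pred I) (F : I -> L2 mu) :
  {ae mu, forall x,
    L2_repr (\sum_(i <- s | P i) F i) x = \sum_(i <- s | P i) L2_repr (F i) x}.
Proof.
elim: s => [|i s ih].
  (* The chosen representative of 0 is only known to vanish almost everywhere, which follows by
     writing 0 as 0 times a class. *)
  rewrite big_nil; have := L2_repr_scale 0 (0 : L2 mu).
  rewrite (scale0r (0 : L2 mu) : L2_scale _ _ = 0).
  by apply: filterS => x ->; rewrite big_nil mul0r.
rewrite big_cons; have [Pi|Pi] := boolP (P i); last first.
  by apply: filterS ih => x ->; rewrite big_cons (negbTE Pi).
apply: filterS2 (L2_repr_add (F i) (\sum_(j <- s | P j) F j)) ih => x -> ->.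
by rewrite big_cons Pi.
Qed.

End square_integrable_functions.

(** * Cuntz-Krieger families of edges and vertices *)

Section cuntz_krieger_families.
Variables (R : realType) (H : lmodType R[i]) (inner : H -> H -> R[i]).
Hypothesis innerDl : forall f g h, inner (f + g) h = inner f h + inner g h.
Hypothesis innerC : forall f g, inner g f = conjc (inner f g).
Hypothesis inner_ge0 : forall f, 0 <= complex.Re (inner f f).
Implicit Types (f g h : H) (T S : H -> H).

Lemma linear_functionD T : linear T -> {morph T : f g / f + g}.
Proof. by move=> lT f g; rewrite -[f in LHS]scale1r lT scale1r. Qed.

Lemma linear_function0 T : linear T -> T 0 = 0.
Proof.
move=> /linear_functionD /(_ 0 0); rewrite addr0 => /eqP.
by rewrite -subr_eq0 opprD addNKr oppr_eq0 => /eqP.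
Qed.

Lemma linear_functionB T f g : linear T -> T (f - g) = T f - T g.
Proof.
move=> lT; apply/eqP; rewrite eq_sym subr_eq -linear_functionD//.
by rewrite subrK.
Qed.

Lemma linear_function_sum T (I : Type) (r : seq I) (P : pred I) (F : I -> H) :
  linear T -> T (\sum_(i <- r | P i) F i) = \sum_(i <- r | P i) T (F i).
Proof.
move=> lT; apply: big_morph; last exact: linear_function0.
exact: linear_functionD.
Qed.

Lemma sum_of_linear (I : Type) (r : seq I) (P : pred I) (F : I -> H -> H) :
  (forall i, linear (F i)) -> linear (fun f => \sum_(i <- r | P i) F i f).
Proof.
move=> lF a f g; rewrite scaler_sumr -big_split; apply: eq_bigr => i _.
exact: lF.
Qed.

Lemma inner0l g : inner 0 g = 0.
Proof.
have /eqP := innerDl 0 0 g.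
by rewrite addr0 -subr_eq0 opprD addNKr oppr_eq0 => /eqP.
Qed.

Lemma inner_suml (I : Type) (r : seq I) (P : pred I) (F : I -> H) g :
  inner (\sum_(i <- r | P i) F i) g = \sum_(i <- r | P i) inner (F i) g.
Proof.
apply: (big_morph (inner^~ g)) => [f h|]; first exact: innerDl.
exact: inner0l.
Qed.

Lemma innerDr f g h : inner f (g + h) = inner f g + inner f h.
Proof. by rewrite innerC innerDl rmorphD /= -!innerC. Qed.

Lemma inner_sumr (I : Type) (r : seq I) (P : pred I) (F : I -> H) f :
  inner f (\sum_(i <- r | P i) F i) = \sum_(i <- r | P i) inner f (F i).
Proof.
apply: (big_morph (inner f)) => [g h|]; first exact: innerDr.
by rewrite innerC inner0l rmorph0.
Qed.

Lemma is_adjointC T S : is_adjoint inner T S -> is_adjoint inner S T.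
Proof. by move=> TS f g; rewrite innerC -TS -innerC. Qed.

(** * Partial isometries from [T S T = T] with [S] adjoint to [T] *)

Section regular.
Variables T S : H -> H.
Hypotheses (lT : linear T) (lS : linear S).
Hypotheses (adjTS : is_adjoint inner T S) (TST : forall f, T (S (T f)) = T f).

Lemma regular_kernel f : T (f - S (T f)) = 0.
Proof. by rewrite linear_functionB// TST subrr. Qed.

(** If [f] is orthogonal to the kernel of [T], which contains [f - S (T f)], then [f] pairs equally
    with [f] and with [S (T f)]; the latter pairing is the square norm of [T f]. *)
Lemma regular_partial_isometry : partial_isometry inner T.
Proof.
move=> f fK; rewrite /hnorm; congr (Num.sqrt (complex.Re _)).
have := fK _ (regular_kernel f) => f0.
by rewrite adjTS -[X in _ = inner _ X](subrK (S (T f))) innerDr f0 add0r.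
Qed.

(* Pythagoras for [f = (f - S T f) + S T f], whose first term is killed by [T]. *)
Lemma regular_bounded_linear : bounded_linear inner T.
Proof.
split=> //; exists 1 => f; rewrite mul1r /hnorm; apply: ler_wsqrtr.
set g := f - S (T f).
have gT h : inner g (S h) = 0 by rewrite -adjTS regular_kernel inner0l.
have STf : inner (S (T f)) f = conjc (inner (T f) (T f)).
  by rewrite innerC -adjTS.
have -> : inner f f = inner g g + conjc (inner (T f) (T f)).
  have fE : f = g + S (T f) by rewrite subrK.
  by rewrite -STf [X in inner X _]fE innerDl [in inner g f]fE innerDr gT addr0.
rewrite [X in _ <= X](_ : _ =
    complex.Re (inner g g) + complex.Re (inner (T f) (T f))).
  by rewrite lerDr inner_ge0.
by case: (inner g g) (inner (T f) (T f)) => [a b] [c d].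
Qed.

End regular.

(** * From the edge relations to the vertex relations *)

Section edges.
Variable B : bratteli.
Local Notation E := (edge B).
Variables T S : E -> H -> H.
Hypotheses (lT : forall e, linear (T e)) (lS : forall e, linear (S e)).
Hypothesis adjTS : forall e, is_adjoint inner (T e) (S e).
Hypothesis sum_TS : forall f, \sum_e T e (S e f) = f.
Hypothesis ST : forall e f, S e (T e f) = \sum_(k | edge_adj e k) T k (S k f).
Hypothesis ST0 : forall e k f, e != k -> S e (T k f) = 0.
Hypothesis TS0 : forall e k f, tgt e != tgt k -> T e (S k f) = 0.

(** Inserting the resolution of the identity [sum_TS] in front of [T e f] leaves only the term of
    index [e]. *)
Lemma edge_TST e f : T e (S e (T e f)) = T e f.
Proof.
rewrite -[RHS]sum_TS (bigD1 e)//= big1 ?addr0// => k ke.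
by rewrite ST0// linear_function0.
Qed.

Lemma edge_STS e f : S e (T e (S e f)) = S e f.
Proof.
rewrite -[f in RHS]sum_TS linear_function_sum// (bigD1 e)//= big1 ?addr0//.
by move=> k ke; rewrite ST0// eq_sym.
Qed.

Lemma edge_cuntz_krieger :
  generates_CK_representation inner (@edge_adj B) T.
Proof.
exists S; split=> [e|//|e|//|//].
- split; first exact: regular_bounded_linear (adjTS e) (edge_TST e).
  apply: regular_bounded_linear (edge_STS e) => //.
  exact: is_adjointC.
- exact: regular_partial_isometry (adjTS e) (edge_TST e).
Qed.

Let Tv (i : B) f := \sum_(e | src e == i) T e f.
Let Sv (i : B) f := \sum_(e | src e == i) S e f.

(** This is where the entries being 0 or 1 enters: edges are coded as pairs of vertices. *)
Lemma edge_eq (e k : E) : src e = src k -> tgt e = tgt k -> e = k.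
Proof.
rewrite /src /tgt => se te; apply: val_inj.
by move: se te; case: (val e) (val k) => [a b] [c d] /= -> ->.
Qed.

(** Distinct edges leaving [i] have distinct ranges, so [TS0] kills every cross term. *)
Lemma vertex_TS i f : Tv i (Sv i f) = \sum_(e | src e == i) T e (S e f).
Proof.
apply: eq_bigr => e /eqP se; rewrite linear_function_sum// (bigD1 e) ?se//=.
rewrite big1 ?addr0// => k /andP[/eqP sk ke]; apply: TS0.
by apply: contra ke => /eqP te; apply/eqP/edge_eq; rewrite ?se ?sk.
Qed.

Lemma vertex_ST i f : Sv i (Tv i f) = \sum_(e | src e == i) S e (T e f).
Proof.
apply: eq_bigr => e /eqP se; rewrite linear_function_sum// (bigD1 e) ?se//=.
by rewrite big1 ?addr0// => k /andP[_ ke]; rewrite ST0// eq_sym.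
Qed.

Lemma vertex_TST i f : Tv i (Sv i (Tv i f)) = Tv i f.
Proof.
rewrite vertex_ST; apply: eq_bigr => e /eqP se.
rewrite linear_function_sum// (bigD1 e) ?se//= edge_TST big1 ?addr0// => k.
move=> /andP[/eqP sk ke]; apply: TS0.
by apply: contra ke => /eqP te; apply/eqP/edge_eq; rewrite ?se ?sk.
Qed.

Lemma vertex_STS i f : Sv i (Tv i (Sv i f)) = Sv i f.
Proof.
rewrite vertex_TS; apply: eq_bigr => e /eqP se.
rewrite linear_function_sum// (bigD1 e) ?se//= edge_STS big1 ?addr0// => k.
by move=> /andP[_ ke]; rewrite ST0// eq_sym.
Qed.

Lemma vertex_adjoint i : is_adjoint inner (Tv i) (Sv i).
Proof.
move=> f g; rewrite inner_suml inner_sumr.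
by apply: eq_bigr => e _; exact: adjTS.
Qed.

(** Through their range, the edges leaving [i] correspond to the [j] with matrix entry 1, and the
    edges following such an edge are those leaving [j]. *)
Lemma sum_outgoing (V : zmodType) i (F : E -> V) :
  \sum_(e | src e == i) \sum_(k | edge_adj e k) F k =
  \sum_(j | adj i j) \sum_(k | src k == j) F k.
Proof.
pose e_ j (ij : adj i j) : E := exist _ (i, j) ij.
rewrite (partition_big (@tgt B) (adj i)) /=; last first.
  by move=> e /eqP <-; exact: (valP e).
apply: eq_bigr => j ij.
rewrite (big_pred1 (e_ j ij)).
  by apply: eq_bigl => k; rewrite /edge_adj eq_sym.
move=> e /=; apply/andP/eqP => [[/eqP se /eqP te]|->].
  exact: edge_eq.
by rewrite !eqxx.
Qed.

Lemma vertex_cuntz_krieger :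
  generates_CK_representation inner (@adj B) Tv.
Proof.
have lTv i : linear (Tv i) by exact: sum_of_linear.
have lSv i : linear (Sv i) by exact: sum_of_linear.
exists Sv; split=> [i|i|i|f|i f].
- split; first exact: regular_bounded_linear (vertex_adjoint i) (vertex_TST i).
  apply: regular_bounded_linear (vertex_STS i) => //.
  exact/is_adjointC/vertex_adjoint.
- exact: vertex_adjoint.
- exact: regular_partial_isometry (vertex_adjoint i) (vertex_TST i).
- under eq_bigr do rewrite vertex_TS.
  rewrite -[RHS]sum_TS [RHS](partition_big (@src B) predT)//=.
- rewrite vertex_ST; under eq_bigr do rewrite ST.
  rewrite sum_outgoing; apply: eq_bigr => j _.
  by rewrite vertex_TS.
Qed.

End edges.
End cuntz_krieger_families.

(** * The operators of the representation *)

Section operators.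
Local Open Scope complex_scope.
Variables (R : realType) (B : bratteli) (m : probability (path_space B) R).
Local Notation E := (edge B).
Local Notation X := (path_space B).
Hypothesis cmp : forall e, comparable_prefixes m e.
Implicit Types (e k : E) (x : X) (f g : X -> R[i]) (psi xi : L2 m).

(** On [R_set e] the exceptional set is the image under [sigma e] of a null set; its measure is the
    [m_sigma] measure of that set, which is 0 by domination. *)
Lemma ae_coding e (P : X -> Prop) : {ae m, forall x, D_set e x -> P x} ->
  {ae m, forall x, R_set e x -> P (coding x)}.
Proof.
move=> [N [mN N0 NP]].
exists (@coding B @^-1` N `&` R_set e); split.
- apply: measurableI; last exact: measurable_R_set.
  by rewrite -[X in measurable X]setTI; exact: measurable_coding.
- rewrite -image_sigma; have /null_content_dominatesP := m_sigma_dominated (@cmp e).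
  exact.
- move=> x /= /not_implyP[Rx nP]; split=> //; apply: NP => /= h.
  by apply/nP/h/D_set_coding.
Qed.

(** [sigma e] sends the exceptional set into a null set, so its [m_sigma] measure is 0 and the
    reverse domination concludes. *)
Lemma ae_sigma e (P : X -> Prop) : {ae m, forall x, R_set e x -> P x} ->
  {ae m, forall x, D_set e x -> P (sigma e x)}.
Proof.
move=> [N [mN N0 NP]].
have mD := @measurable_D_set B e.
have mS : measurable (D_set e `&` sigma e @^-1` N).
  apply: measurableI => //.
  by rewrite -[X in measurable X]setTI; exact: measurable_sigma.
exists (D_set e `&` sigma e @^-1` N); split=> //.
- apply: (dominated_m_sigma (@cmp e)) => //.
  apply: (@subset_measure0 _ _ _ m _ N) => //; first exact: measurable_image_sigma.
  by move=> _ [x [[_ Nx] _] <-].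
- move=> x /= /not_implyP[Dx nP]; split=> //; apply: NP => /= h.
  by apply/nP/h/R_set_sigma.
Qed.

(** Pointwise form of the operator, on functions instead of classes; identities are checked there
    and then moved to [L2]. *)
Definition T_fun e f x : R[i] :=
  (\1_(R_set e) x * rho m e (coding x) `^ (- 2^-1))%:C * f (coding x).

Definition T_star_fun e f x : R[i] :=
  (\1_(D_set e) x * rho m e x `^ 2^-1)%:C * f (sigma e x).

Lemma T_funE e f x : R_set e x ->
  T_fun e f x = (rho m e (coding x) `^ (- 2^-1))%:C * f (coding x).
Proof. by move=> Rx; rewrite /T_fun indicE mem_set// mul1r. Qed.

Lemma T_fun0 e f x : ~ R_set e x -> T_fun e f x = 0.
Proof. by move=> Rx; rewrite /T_fun indicE memNset// mul0r mul0r. Qed.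

Lemma T_star_funE e f x : D_set e x ->
  T_star_fun e f x = (rho m e x `^ 2^-1)%:C * f (sigma e x).
Proof. by move=> Dx; rewrite /T_star_fun indicE mem_set// mul1r. Qed.

Lemma T_star_fun0 e f x : ~ D_set e x -> T_star_fun e f x = 0.
Proof. by move=> Dx; rewrite /T_star_fun indicE memNset// mul0r mul0r. Qed.

Lemma ae_T_fun e f g : {ae m, forall x, f x = g x} ->
  {ae m, forall x, T_fun e f x = T_fun e g x}.
Proof.
move=> fg; have : {ae m, forall x, D_set e x -> f x = g x}.
  by apply: filterS fg => x.
move=> /ae_coding; apply: filterS => x h.
have [Rx|Rx] := pselect (R_set e x); first by rewrite !T_funE// h.
by rewrite !T_fun0.
Qed.

Lemma ae_T_star_fun e f g : {ae m, forall x, f x = g x} ->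
  {ae m, forall x, T_star_fun e f x = T_star_fun e g x}.
Proof.
move=> fg; have : {ae m, forall x, R_set e x -> f x = g x}.
  by apply: filterS fg => x.
move=> /ae_sigma; apply: filterS => x h.
have [Dx|Dx] := pselect (D_set e x); first by rewrite !T_star_funE// h.
by rewrite !T_star_fun0.
Qed.

Lemma powR_half_sqr (a : R) : 0 < a -> (a `^ 2^-1) ^+ 2 = a.
Proof. by move=> a0; rewrite powR12_sqrt ?sqr_sqrtr// ltW. Qed.

(** The weights are the powers [-1/2] and [1/2] of [rho] at the same point [coding x], and cancel
    where [rho] is positive. *)
Lemma T_fun_T_star_fun e f :
  {ae m, forall x, T_fun e (T_star_fun e f) x = \1_(R_set e) x * f x}.
Proof.
have := ae_coding (rho_gt0 (@cmp e)); apply: filterS => x r0.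
have [Rx|Rx] := pselect (R_set e x); last first.
  by rewrite T_fun0// indicE memNset// mul0r.
rewrite T_funE// T_star_funE; last exact: D_set_coding.
rewrite codingK// mulrA -rmorphM /= powRN mulVf ?rmorph1 ?indicE ?mem_set//.
by rewrite gt_eqF// powR_gt0// r0.
Qed.

Lemma T_star_fun_T_fun e f :
  {ae m, forall x, T_star_fun e (T_fun e f) x = \1_(D_set e) x * f x}.
Proof.
have := rho_gt0 (@cmp e); apply: filterS => x r0.
have [Dx|Dx] := pselect (D_set e x); last first.
  by rewrite T_star_fun0// indicE memNset// mul0r.
rewrite T_star_funE// T_funE; last exact: R_set_sigma.
rewrite sigmaK// mulrA -rmorphM /= powRN divff ?rmorph1 ?indicE ?mem_set//.
by rewrite gt_eqF// powR_gt0// r0.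
Qed.

Lemma T_fun_T_star_fun0 e k f x : tgt e != tgt k -> T_fun e (T_star_fun k f) x = 0.
Proof.
move=> /eqP ek; have [Rx|Rx] := pselect (R_set e x); last by rewrite T_fun0.
rewrite T_funE// T_star_fun0 ?mulr0// => Dx; apply: ek.
by rewrite -Dx (D_set_coding Rx).
Qed.

Lemma T_star_fun_T_fun0 e k f x : e != k -> T_star_fun e (T_fun k f) x = 0.
Proof.
move=> /eqP ek; have [Dx|Dx] := pselect (D_set e x); last by rewrite T_star_fun0.
rewrite T_star_funE// T_fun0 ?mulr0// => Rx; apply: ek.
by rewrite -Rx; have := R_set_sigma Dx.
Qed.

Lemma measurable_T_coef e : measurable_fun [set: X]
  (fun x => \1_(R_set e) x * rho m e (coding x) `^ (- 2^-1) : R).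
Proof.
apply: measurable_funM; first by apply: measurable_indic; exact: measurable_R_set.
apply: (@measurableT_comp _ _ _ _ _ _ (fun a : R => a `^ _)).
  exact: measurable_powR.
apply: measurableT_comp; last exact: measurable_coding.
exact: measurable_rho.
Qed.

Lemma measurable_T_star_coef e : measurable_fun [set: X]
  (fun x => \1_(D_set e) x * rho m e x `^ 2^-1 : R).
Proof.
apply: measurable_funM; first by apply: measurable_indic; exact: measurable_D_set.
apply: (@measurableT_comp _ _ _ _ _ _ (fun a : R => a `^ _)).
  exact: measurable_powR.
exact: measurable_rho.
Qed.

(** * Integration along [sigma e] and action on square-integrable functions *)

Lemma integral_sigma e (h : X -> R) : measurable_fun [set: X] h ->
  (\int[m]_(x in R_set e) (h x)%:E =
   \int[m]_(x in D_set e) (h (sigma e x) * `|rho m e x|)%:E)%E.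
Proof.
move=> mh; rewrite integralE [RHS]integralE; congr (_ - _)%E.
- rewrite (ge0_integral_sigma (@cmp e)); last 2 first.
  + by apply: measurable_funepos; exact/measurable_EFinP.
  + by move=> x; exact: funepos_ge0.
  apply: eq_integral => x _; rewrite !funeposE -!EFin_max -EFinM.
  by rewrite maxr_pMl// mul0r.
- rewrite (ge0_integral_sigma (@cmp e)); last 2 first.
  + by apply: measurable_funeneg; exact/measurable_EFinP.
  + by move=> x; exact: funeneg_ge0.
  apply: eq_integral => x _; rewrite !funenegE -!EFinN -!EFin_max -EFinM.
  by rewrite maxr_pMl// mul0r mulNr.
Qed.

Lemma integral_R_set e (h : X -> R) : measurable_fun [set: X] h ->
  (forall x, ~ R_set e x -> h x = 0) ->
  (\int[m]_x (h x)%:E =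
   \int[m]_(x in D_set e) (h (sigma e x) * rho m e x)%:E)%E.
Proof.
move=> mh h0; transitivity (\int[m]_(x in R_set e) (h x)%:E)%E.
  rewrite [RHS]integral_mkcond; apply: eq_integral => x _.
  by rewrite patchE; have [Rx|Rx] := pselect (R_set e x);
    [rewrite mem_set|rewrite memNset// h0].
have mhs : measurable_fun [set: X] (fun x => h (sigma e x)).
  by apply: measurableT_comp => //; exact: measurable_sigma.
have mr := measurable_rho (@cmp e).
rewrite integral_sigma//; apply: ae_eq_integral.
- exact: measurable_D_set.
- apply: measurable_funTS; apply/measurable_EFinP; apply: measurable_funM => //.
  exact: measurableT_comp.
- by apply: measurable_funTS; apply/measurable_EFinP; exact: measurable_funM.
- by apply: filterS (rho_gt0 (@cmp e)) => x + Dx => /(_ Dx) r0; rewrite gtr0_norm.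
Qed.

Lemma integral_D_set e (h : X -> R) : (forall x, ~ D_set e x -> h x = 0) ->
  (\int[m]_x (h x)%:E = \int[m]_(x in D_set e) (h x)%:E)%E.
Proof.
move=> h0; rewrite [RHS]integral_mkcond; apply: eq_integral => x _.
by rewrite patchE; have [Dx|Dx] := pselect (D_set e x);
  [rewrite mem_set|rewrite memNset// h0].
Qed.

(** The squared weight is the inverse of the Jacobian, so the square norm becomes the integral of
    the square modulus of [f] over [D_set e]. *)
Lemma T_fun_l2 e f : f \in l2_pred m -> T_fun e f \in l2_pred m.
Proof.
move=> /asboolP[fr fi foo]; apply/asboolP.
have mc := measurable_T_coef e; have mcod := @measurable_coding B.
have mr : measurable_fun [set: X] (fun x => complex.Re (T_fun e f x)).
  under eq_fun do rewrite Re_scale.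
  by apply: measurable_funM => //; exact: (measurableT_comp fr).
have mi : measurable_fun [set: X] (fun x => complex.Im (T_fun e f x)).
  under eq_fun do rewrite Im_scale.
  by apply: measurable_funM => //; exact: (measurableT_comp fi).
split=> //; apply: le_lt_trans foo.
have msq : measurable_fun [set: X] (fun x => sqmod (T_fun e f x)).
  exact/measurable_EFinP/measurable_sqmod.
rewrite (integral_R_set (e := e) msq); last first.
  by move=> x Rx; rewrite T_fun0// /sqmod /= expr0n addr0.
have mf : measurable_fun [set: X] (fun x => (sqmod (f x))%:E).
  exact: measurable_sqmod.
apply: (@le_trans _ _ (\int[m]_(x in D_set e) (sqmod (f x))%:E)%E); last first.
  apply: ge0_subset_integral => //; first exact: measurable_D_set.
  by move=> x _; rewrite lee_fin sqmod_ge0.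
rewrite le_eqVlt; apply/orP; left; apply/eqP; apply: ae_eq_integral.
- exact: measurable_D_set.
- apply: measurable_funTS; apply/measurable_EFinP; apply: measurable_funM.
    by apply: (measurableT_comp msq); exact: measurable_sigma.
  exact: measurable_rho.
- exact: measurable_funTS.
apply: filterS (rho_gt0 (@cmp e)) => x + Dx => /(_ Dx) r0.
rewrite T_funE; last exact: R_set_sigma.
rewrite sigmaK// sqmod_scale powRN exprVn powR_half_sqr// mulrAC mulVf ?mul1r//.
exact: lt0r_neq0.
Qed.

Lemma T_star_fun_l2 e f : f \in l2_pred m -> T_star_fun e f \in l2_pred m.
Proof.
move=> /asboolP[fr fi foo]; apply/asboolP.
have mc := measurable_T_star_coef e; have ms := @measurable_sigma B e.
have mr : measurable_fun [set: X] (fun x => complex.Re (T_star_fun e f x)).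
  under eq_fun do rewrite Re_scale.
  by apply: measurable_funM => //; exact: (measurableT_comp fr).
have mi : measurable_fun [set: X] (fun x => complex.Im (T_star_fun e f x)).
  under eq_fun do rewrite Im_scale.
  by apply: measurable_funM => //; exact: (measurableT_comp fi).
split=> //; apply: le_lt_trans foo.
have mf : measurable_fun [set: X] (fun x => sqmod (f x)).
  exact/measurable_EFinP/measurable_sqmod.
have mRf : measurable_fun [set: X] (fun x => \1_(R_set e) x * sqmod (f x)).
  apply: measurable_funM => //.
  by apply: measurable_indic; exact: measurable_R_set.
rewrite (@integral_D_set e); last first.
  by move=> x Dx; rewrite T_star_fun0// /sqmod /= expr0n addr0.
(* The indicator makes the integrand vanish off [R_set e], as the change of variables demands; the
   squared weight is now the Jacobian itself. *)
apply: (@le_trans _ _ (\int[m]_x (\1_(R_set e) x * sqmod (f x))%:E)%E); last first.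
  apply: ge0_le_integral => //.
  - by move=> x _; rewrite lee_fin mulr_ge0 ?sqmod_ge0.
  - exact/measurable_EFinP.
  - exact/measurable_EFinP.
  - by move=> x _; rewrite lee_fin ler_piMl ?sqmod_ge0// indicE; case: (_ \in _).
rewrite (integral_R_set (e := e) mRf); last first.
  by move=> x Rx; rewrite indicE memNset// mul0r.
rewrite le_eqVlt; apply/orP; left; apply/eqP; apply: ae_eq_integral.
- exact: measurable_D_set.
- exact/measurable_funTS/measurable_sqmod.
- apply: measurable_funTS; apply/measurable_EFinP; apply: measurable_funM.
    exact: (measurableT_comp mRf).
  exact: measurable_rho.
apply: filterS (rho_gt0 (@cmp e)) => x + Dx => /(_ Dx) r0.
rewrite T_star_funE// sqmod_scale powR_half_sqr// indicE mem_set ?mul1r 1?mulrC//.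
exact: R_set_sigma.
Qed.

(** * The relations on classes of functions *)

Lemma L2_repr_T e psi :
  {ae m, forall x, L2_repr (T_tilde e psi) x = T_fun e (L2_repr psi) x}.
Proof. exact/L2_classK/T_fun_l2/L2_repr_l2. Qed.

Lemma L2_repr_T_star e psi :
  {ae m, forall x, L2_repr (T_tilde_star e psi) x = T_star_fun e (L2_repr psi) x}.
Proof. exact/L2_classK/T_star_fun_l2/L2_repr_l2. Qed.

Lemma L2_repr_lin a psi xi : {ae m, forall x,
  L2_repr (a *: psi + xi) x = a * L2_repr psi x + L2_repr xi x}.
Proof.
apply: filterS2 (L2_repr_add (a *: psi) xi) (L2_repr_scale a psi) => x ->.
by move=> <-.
Qed.

Lemma T_tilde_linear e : linear (@T_tilde R B m e).
Proof.
move=> a psi xi; apply: L2_eq.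
have hT := L2_repr_T e; have := ae_T_fun e (L2_repr_lin a psi xi).
apply: filter_app; apply: filter_app (hT (a *: psi + xi)).
apply: filter_app (hT psi); apply: filter_app (hT xi).
apply: filterS (L2_repr_lin a (T_tilde e psi) (T_tilde e xi)) => x.
move=> -> -> -> -> ->.
by rewrite /T_fun mulrDr; congr (_ + _); rewrite mulrCA.
Qed.

Lemma T_tilde_star_linear e : linear (@T_tilde_star R B m e).
Proof.
move=> a psi xi; apply: L2_eq.
have hT := L2_repr_T_star e; have := ae_T_star_fun e (L2_repr_lin a psi xi).
apply: filter_app; apply: filter_app (hT (a *: psi + xi)).
apply: filter_app (hT psi); apply: filter_app (hT xi).
apply: filterS (L2_repr_lin a (T_tilde_star e psi) (T_tilde_star e xi)) => x.
move=> -> -> -> -> ->.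
by rewrite /T_star_fun mulrDr; congr (_ + _); rewrite mulrCA.
Qed.

Lemma L2_repr_T_T_star e k psi : {ae m, forall x,
  L2_repr (T_tilde e (T_tilde_star k psi)) x =
  T_fun e (T_star_fun k (L2_repr psi)) x}.
Proof.
apply: filterS2 (L2_repr_T e (T_tilde_star k psi))
  (ae_T_fun e (L2_repr_T_star k psi)) => x -> //.
Qed.

Lemma L2_repr_T_star_T e k psi : {ae m, forall x,
  L2_repr (T_tilde_star e (T_tilde k psi)) x =
  T_star_fun e (T_fun k (L2_repr psi)) x}.
Proof.
apply: filterS2 (L2_repr_T_star e (T_tilde k psi))
  (ae_T_star_fun e (L2_repr_T k psi)) => x -> //.
Qed.

Lemma L2_repr0 : {ae m, forall x, L2_repr (0 : L2 m) x = 0}.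
Proof.
by have := @L2_repr_sum _ _ _ m nat [::] xpredT (fun _ => 0); rewrite big_nil;
  apply: filterS => x ->; rewrite big_nil.
Qed.

Lemma T_tilde_T_tilde_star0 e k psi : tgt e != tgt k ->
  T_tilde e (T_tilde_star k psi) = 0.
Proof.
move=> ek; apply: L2_eq; apply: filterS2 (L2_repr_T_T_star e k psi) L2_repr0.
by move=> x -> ->; exact: T_fun_T_star_fun0.
Qed.

Lemma T_tilde_star_T_tilde0 e k psi : e != k ->
  T_tilde_star e (T_tilde k psi) = 0.
Proof.
move=> ek; apply: L2_eq; apply: filterS2 (L2_repr_T_star_T e k psi) L2_repr0.
by move=> x -> ->; exact: T_star_fun_T_fun0.
Qed.

Lemma L2_repr_range_projection e psi : {ae m, forall x,
  L2_repr (T_tilde e (T_tilde_star e psi)) x = \1_(R_set e) x * L2_repr psi x}.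
Proof.
apply: filterS2 (L2_repr_T_T_star e e psi)
  (T_fun_T_star_fun e (L2_repr psi)) => x.
by move=> -> ->.
Qed.

Lemma ae_all_edges (P : E -> X -> Prop) : (forall e, {ae m, forall x, P e x}) ->
  {ae m, forall x, forall e, P e x}.
Proof.
move=> h.
have [e0 _] := has_out_edge (enum_val (Ordinal (vertex_gt0 B))).
(* Listing the edges as a sequence with default [e0] reduces to a countable intersection. *)
have : {ae m, forall x n, P (nth e0 (enum E) n) x} by apply: ae_foralln => n.
apply: filterS => x Px e; rewrite -[e](nth_index e0 (mem_enum E e)).
exact: Px.
Qed.

(** The sets [R_set e] partition the path space by the first edge, so exactly one indicator is 1 at
    each point. *)
Lemma L2_repr_sum_range_projections (P : pred E) psi : {ae m, forall x,
  L2_repr (\sum_(e | P e) T_tilde e (T_tilde_star e psi)) x =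
  (P (pedge x 1))%:R * L2_repr psi x}.
Proof.
have := ae_all_edges (fun e => L2_repr_range_projection e psi).
have := L2_repr_sum (index_enum E) P (fun e => T_tilde e (T_tilde_star e psi)).
apply: filterS2 => x -> h; under eq_bigr do rewrite h indicE.
rewrite -big_distrl /=; congr (_ * _).
rewrite big_mkcond (bigD1 (pedge x 1))//= big1 ?addr0 => [|e ex].
  by case: ifP => // _; rewrite mem_set.
case: ifP => // _; rewrite memNset// => xe; move: ex.
by rewrite -xe eqxx.
Qed.

Lemma sum_T_tilde_T_tilde_star psi :
  \sum_e T_tilde e (T_tilde_star e psi) = psi.
Proof.
apply: L2_eq; apply: filterS (L2_repr_sum_range_projections xpredT psi) => x ->.
by rewrite mul1r.
Qed.

(** [D_set e] is the union of the [R_set k] over the edges [k] that may follow [e], so both sides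
    multiply by its indicator. *)
Lemma T_tilde_star_T_tilde e psi : T_tilde_star e (T_tilde e psi) =
  \sum_(k | edge_adj e k) T_tilde k (T_tilde_star k psi).
Proof.
apply: L2_eq; apply: filter_app (L2_repr_sum_range_projections (edge_adj e) psi).
apply: filterS2 (L2_repr_T_star_T e e psi)
  (T_star_fun_T_fun e (L2_repr psi)) => x -> -> ->.
congr (_ * _); rewrite indicE /edge_adj eq_sym; congr (nat_of_bool _)%:R.
by apply/idP/eqP; rewrite inE.
Qed.

Lemma T_tilde_adjoint e :
  is_adjoint (@L2_inner _ _ R m) (T_tilde e) (T_tilde_star e).
Proof.
move=> psi xi; have pl := L2_repr_l2 psi; have xl := L2_repr_l2 xi.
have Tl := T_fun_l2 e pl; have Sl := T_star_fun_l2 e xl.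
rewrite (L2_innerE Tl xl (L2_repr_T e psi) (aeW _ (fun _ => erefl))).
rewrite (L2_innerE pl Sl (aeW _ (fun _ => erefl)) (L2_repr_T_star e xi)).
(* One computation serves the real and the imaginary part, which share homogeneity under real
   scalars. *)
have adj (L : R[i] -> R) (f := L2_repr psi) (g := L2_repr xi) :
    (forall a z, L (a%:C * z) = a * L z) ->
    measurable_fun [set: X] (fun x => L (T_fun e f x * conjc (g x))) ->
    measurable_fun [set: X] (fun x => L (f x * conjc (T_star_fun e g x))) ->
    (\int[m]_x L (T_fun e f x * conjc (g x)) =
     \int[m]_x L (f x * conjc (T_star_fun e g x)))%R.
  move=> LZ mL1 mL2; have L0 : L 0 = 0 by rewrite -[0](mul0r 0) (LZ 0) mul0r.
  congr fine; rewrite (integral_R_set (e := e) mL1); last first.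
    by move=> x Rx; rewrite T_fun0// mul0r L0.
  rewrite (@integral_D_set e); last first.
    by move=> x Dx; rewrite T_star_fun0// conjc0 mulr0 L0.
  apply: ae_eq_integral.
  - exact: measurable_D_set.
  - apply: measurable_funTS; apply/measurable_EFinP; apply: measurable_funM.
      by apply: (measurableT_comp mL1); exact: measurable_sigma.
    exact: measurable_rho.
  - exact/measurable_funTS/measurable_EFinP.
  apply: filterS (rho_gt0 (@cmp e)) => x + Dx => /(_ Dx) r0.
  rewrite T_funE; last exact: R_set_sigma.
  rewrite sigmaK// T_star_funE// conjc_scale -mulrA [in RHS]mulrCA !LZ.
  (* With [q] the square root of [rho], the inverse of [q] times [rho] is [q]. *)
  set q := _ `^ 2^-1; congr _%:E; rewrite mulrAC; congr (_ * _).
  rewrite -[X in _ * X](powR_half_sqr r0) powRN expr2 mulrA mulVf ?mul1r//.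
  by rewrite gt_eqF// powR_gt0.
congr (_ +i* _).
- apply: (adj (@complex.Re R)); first exact: Re_scale.
    exact: measurable_Re_conj Tl xl.
  exact: measurable_Re_conj pl Sl.
- apply: (adj (@complex.Im R)); first exact: Im_scale.
    exact: measurable_Im_conj Tl xl.
  exact: measurable_Im_conj pl Sl.
Qed.

End operators.

Theorem theorem4p12 (R : realType) (B : bratteli)
    (cantorX : cantor_set (path_space B))
    (m : probability (path_space B) R) (atomless : nonatomic m)
    (hm : tail_invariant m \/ stationary_markov m \/ quasi_stationary_markov m) :
  [/\ forall e : edge B, is_adjoint (@L2_inner _ _ R m) (T_tilde e) (T_tilde_star e),
      generates_CK_representation (@L2_inner _ _ R m) (@edge_adj B) (@T_tilde R B m) &
      generates_CK_representation (@L2_inner _ _ R m) (@adj B) (@T_vertex R B m)].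
Proof.
(* The kind of measure matters only here; the rest uses comparability on cylinders. *)
have cmp e : comparable_prefixes m e by exact: comparable_prefixesP.
have adjT e := T_tilde_adjoint cmp e.
have lT e := T_tilde_linear cmp e.
have lS e := T_tilde_star_linear cmp e.
split=> //.
- apply: (edge_cuntz_krieger (@L2_innerDl _ _ R m) (@L2_innerC _ _ R m)
    (@L2_inner_ge0 _ _ R m) lT lS adjT).
  + exact: sum_T_tilde_T_tilde_star.
  + exact: T_tilde_star_T_tilde.
  + exact: T_tilde_star_T_tilde0.
- apply: (vertex_cuntz_krieger (@L2_innerDl _ _ R m) (@L2_innerC _ _ R m)
    (@L2_inner_ge0 _ _ R m) lT lS adjT).
  + exact: sum_T_tilde_T_tilde_star.
  + exact: T_tilde_star_T_tilde.
  + exact: T_tilde_star_T_tilde0.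
  + exact: T_tilde_T_tilde_star0.
Qed.
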